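(* A functional $C \colon \mathcal{P}_\infty \to \mathbb{R}$ satisfies 1. (Certainty) $C(x) = x$ for all $x \in \mathbb{R}$; 2. (Monotonicity) if $X$ is a mean preserving spread of $Y$ then $C(X) \leq C(Y)$; and 3. (Additivity) if $X, Y$ are independent then $C(X+Y) = C(X) + C(Y)$; if and only if there exists $k \geq 0$ such that $$C(X) = \mathbb{E}[X] - k\,\mathrm{Var}[X] \quad \text{for all } X \in \mathcal{P}_\infty.$$
   Context: $\mathcal{P}_\infty$ is the set of real random variables $X$ with all finite moments ($\mathbb{E}[|X|^n]<\infty$ for all $n\in\mathbb{N}$), on an underlying probability space rich enough to support sequences of independent random variables with arbitrary distributions (e.g. an atomless one). For $x\in\mathbb{R}$, $x$ also denotes the constant random variable taking value $x$. $Y \geq_2 X$ ($Y$ second-order stochastically dominates $X$) means $\mathbb{E}[\phi(Y)] \geq \mathbb{E}[\phi(X)]$ for every concave increasing (i.e. non-decreasing) $\phi:\mathbb{R}\to\mathbb{R}$ for which the two expectations are well defined. $X$ is a mean preserving spread of $Y$ if $\mathbb{E}[X]=\mathbb{E}[Y]$ and $Y \geq_2 X$ (this includes the case where $X$ and $Y$ have the same distribution). *)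

(* Defs.v *)
From HB Require Import structures.
From mathcomp Require Import all_boot all_order all_algebra finmap.
From mathcomp Require Import all_classical all_reals all_analysis measurable_realfun.

Set Implicit Arguments.
Unset Strict Implicit.
Unset Printing Implicit Defensive.

Import Order.TTheory GRing.Theory Num.Theory.
Import numFieldNormedType.Exports.

Local Open Scope classical_set_scope.
Local Open Scope ring_scope.

Section Independence.
Context d (T : measurableType d) (R : realType) (P : probability T R).

Definition independent_pair (X Y : {mfun T >-> R}) : Prop :=
  forall A B : set R, measurable A -> measurable B ->
    P (X @^-1` A `&` Y @^-1` B) = (P (X @^-1` A) * P (Y @^-1` B))%E.

Definition independent_seq (X : nat -> {mfun T >-> R}) : Prop :=
  forall (J : {fset nat}) (A : nat -> set R), (forall i, measurable (A i)) ->
    P (\bigcap_(i in [set` J]) X i @^-1` A i)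
    = (\prod_(i <- J) P (X i @^-1` A i))%E.

(* The space carries independent sequences with arbitrary prescribed laws;
   every atomless probability space has this property. *)
Definition rich : Prop :=
  forall mu : nat -> probability R R,
    exists X : nat -> {mfun T >-> R},
      independent_seq X /\
      forall n (A : set R), measurable A -> distribution P (X n) A = mu n A.

End Independence.

Section FiniteMoments.
Context d (T : measurableType d) (R : realType) (P : probability T R).

Definition finite_moments (X : {mfun T >-> R}) : Prop :=
  forall n : nat, ('E_P[fun w => (`|X w| ^+ n)%R] < +oo)%E.

Record Pinfty := MkPinfty {
  Pinfty_rv :> {mfun T >-> R};
  Pinfty_moments : finite_moments Pinfty_rv }.

Lemma finite_moments_cst (x : R) : finite_moments (cst x : {mfun T >-> R}).
Proof. by move=> n; rewrite (expectation_cst P (`|x| ^+ n)) ltry. Qed.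

Lemma finite_moments_add (X Y : {mfun T >-> R}) :
  finite_moments X -> finite_moments Y -> finite_moments (X + Y).
Proof.
move=> hX hY n.
have m (Z : {mfun T >-> R}) :
    measurable_fun [set: T] (fun w => (`|Z w| ^+ n)%:E).
  apply/measurable_EFinP; apply: measurable_funX.
  exact: measurableT_comp.
have := hX n; have := hY n; rewrite unlock => hYn hXn.
apply: (@le_lt_trans _ _
    (\int[P]_w ((2 ^+ n)%:E * ((`|X w| ^+ n)%:E + (`|Y w| ^+ n)%:E)))%E).
  apply: ge0_le_integral => //.
  - apply: measurable_funeM; apply: emeasurable_funD; exact: m.
  move=> w _; rewrite -EFinD -EFinM lee_fin mfunD/=.
  have hw (a b : R) : `|a| <= `|b| ->
      `|a + b| ^+ n <= 2 ^+ n * (`|a| ^+ n + `|b| ^+ n).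
    move=> ab; apply: (@le_trans _ _ ((2 * `|b|) ^+ n)).
      rewrite lerXn2r ?nnegrE ?mulr_ge0//.
      by rewrite (le_trans (ler_normD _ _))// mulr_natl mulr2n lerD2r.
    by rewrite exprMn ler_wpM2l ?exprn_ge0// lerDr exprn_ge0.
  have [/hw//|/ltW/hw] := leP `|X w| `|Y w|.
  by rewrite addrC [X in _ * X]addrC.
rewrite ge0_integralZl//; last 2 first.
- by apply: emeasurable_funD; exact: m.
- by move=> w _; rewrite -EFinD lee_fin addr_ge0// exprn_ge0.
rewrite ge0_integralD//; do 1?[exact: m | by move=> w _; rewrite lee_fin exprn_ge0].
by rewrite lte_mul_pinfty ?lee_fin ?exprn_ge0// lte_add_pinfty.
Qed.

Definition Pinfty_cst (x : R) : Pinfty := MkPinfty (finite_moments_cst x).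

Definition Pinfty_add (X Y : Pinfty) : Pinfty :=
  MkPinfty (finite_moments_add (@Pinfty_moments X) (@Pinfty_moments Y)).

End FiniteMoments.

Section StochasticOrder.
Context d (T : measurableType d) (R : realType) (P : probability T R).

Definition concave (phi : R -> R) : Prop :=
  forall t x y : R, 0 <= t <= 1 ->
    t * phi x + (1 - t) * phi y <= phi (t * x + (1 - t) * y).

(* The expectation exists in [-oo, +oo], i.e. is not of the form oo - oo. *)
Definition expectation_well_defined (f : T -> R) : Prop :=
  (\int[P]_w ((EFin \o f)^\+ w) < +oo)%E \/
  (\int[P]_w ((EFin \o f)^\- w) < +oo)%E.

(* Y >=_2 X. *)
Definition ssd (Y X : T -> R) : Prop :=
  forall phi : R -> R, concave phi -> {homo phi : x y / x <= y} ->
    expectation_well_defined (phi \o X) ->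
    expectation_well_defined (phi \o Y) ->
    ('E_P[phi \o X] <= 'E_P[phi \o Y])%E.

Definition mean_preserving_spread (X Y : T -> R) : Prop :=
  ('E_P[X] = 'E_P[Y])%E /\ ssd Y X.

End StochasticOrder.

Arguments Pinfty_cst {d T R} P x.

(* Main.v *)
(* Independent noise erases everything about a distribution but its mean and
   variance. Let E[X] = E[Y] = 0 and Var[Y] < Var[X], and let Z be independent
   noise with density h proportional to 1/G(|z|), where G(s) is the sum of
   b_n s^n / n! for weights with b_(m+n) <= b_m b_n, so that
   G(s + t) <= G(s) G(t). G grows faster than every polynomial, so Z has all
   moments, while small weights keep E[X^2 G(|X|)] close to E[X^2]. Since
   h(z) / h(t) lies between 1/G(|z - t|) and G(|z - t|), the second-order
   remainder at 0 of x |-> E[(t - x - Z)^+] is h(t) x^2 / 2 up to a factor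
   G(|x|) or 1/G(|x|). Averaging over X and Y yields
   E[(t - Y - Z)^+] <= E[(t - X - Z)^+] for every t, that is Y + Z >=_2 X + Z,
   and additivity cancels Z: C(X) <= C(Y). Comparing sums of n independent
   copies of X with sums of m copies of a fixed centered B, for n Var[X] close
   to m Var[B], then forces C(X) = C(B) Var[X] / Var[B].

   Conversely, the test functions -((m - x)^+)^2 show, as m tends to infinity,
   that a mean preserving spread increases the variance. *)
Require Import Defs.
From HB Require Import structures.
From mathcomp Require Import all_boot all_order all_algebra finmap.
From mathcomp Require Import all_classical all_reals all_analysis measurable_realfun.
From mathcomp Require Import ring lra.
Import Order.TTheory GRing.Theory Num.Theory.
Import numFieldNormedType.Exports.
Local Open Scope classical_set_scope.
Local Open Scope ring_scope.

Set Implicit Arguments.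
Unset Strict Implicit.
Unset Printing Implicit Defensive.

(** * Moments and independence *)

Section Moments.
Context d (T : measurableType d) (R : realType) (P : probability T R).

Lemma finite_moments_integrable (X : {mfun T >-> R}) (n : nat) :
  finite_moments P X -> P.-integrable setT (fun w => (`|X w| ^+ n)%:E).
Proof.
move=> /(_ n) hX; apply/integrableP; split.
  apply/measurable_EFinP/measurable_funX.
  exact: measurableT_comp.
move: hX; rewrite unlock; under [X in _ -> (X < _)%E]eq_integral => w _.
  rewrite gee0_abs ?lee_fin ?exprn_ge0//. over.
by [].
Qed.

Lemma finite_moments_le_integrable (X : {mfun T >-> R}) (n : nat) (a b : R)
    (f : T -> R) : finite_moments P X -> measurable_fun setT f ->
  (forall w, `|f w| <= a + b * `|X w| ^+ n) -> P.-integrable setT (EFin \o f).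
Proof.
move=> hX mf fX.
have intX := finite_moments_integrable n hX.
have : P.-integrable setT (EFin \o cst a \+ (fun w => b%:E * (`|X w| ^+ n)%:E))%E.
  by apply: integrableD => //; [exact: finite_measure_integrable_cst|exact: integrableZl].
apply: le_integrable => //; first exact/measurable_EFinP.
move=> w _ /=; rewrite lee_fin.
exact: le_trans (fX w) (ler_norm _).
Qed.

Lemma finite_moments_Lfun1 (X : {mfun T >-> R}) :
  finite_moments P X -> (X : T -> R) \in Lfun P 1.
Proof.
move=> hX; apply/Lfun1_integrable.
by apply: (@finite_moments_le_integrable X 1 0 1) => // w; rewrite add0r mul1r expr1.
Qed.

Lemma finite_moments_Lfun2 (X : {mfun T >-> R}) :
  finite_moments P X -> (X : T -> R) \in Lfun P 2%:E.
Proof.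
move=> hX; rewrite inE; apply/andP; split; rewrite inE//=.
rewrite /finite_norm unlock /=.
rewrite poweR_lty//.
under eq_integral do rewrite -[2]/(2%:R) powR_mulrn//.
have := hX 2; rewrite unlock.
by [].
Qed.

End Moments.

Section IndependentPair.
Context d (T : measurableType d) (R : realType) (P : probability T R).
Variables (X Y : {mfun T >-> R}).
Hypothesis XY : independent_pair P X Y.

Let XYpair : T -> R * R := fun w => (X w, Y w).

Let measurable_XYpair : measurable_fun setT XYpair.
Proof. exact: measurable_fun_pair. Qed.

HB.instance Definition _ := @isMeasurableFun.Build _ _ _ _ XYpair measurable_XYpair.

(** Independence only speaks of rectangles, but a product measure is determined by its values
    there. *)
Let product_distribution (A : set (R * R)) : measurable A ->
  (distribution P X \x distribution P Y)%E A = distribution P XYpair A.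
Proof.
by move=> mA; apply: product_measure_unique => // B C mB mC; exact: XY.
Qed.

Lemma independent_ge0_integral (g : R * R -> \bar R) :
  measurable_fun setT g -> (forall z, (0 <= g z)%E) ->
  (\int[P]_w g (X w, Y w) = \int[P]_w \int[P]_v g (X w, Y v))%E.
Proof.
move=> mg g0.
transitivity (\int[distribution P XYpair]_z g z)%E.
  by rewrite ge0_integral_distribution.
transitivity (\int[(distribution P X \x distribution P Y)%E]_z g z)%E.
  by apply: eq_measure_integral => A mA _; exact/esym/product_distribution.
rewrite fubini_tonelli1// ge0_integral_distribution//; last 2 first.
- exact: measurable_fun_fubini_tonelli_F.
- by move=> y; apply: integral_ge0.
apply: eq_integral => w _ /=; rewrite /fubini_F ge0_integral_distribution//.
by apply: measurableT_comp => //; exact: measurable_fun_pair.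
Qed.

(** Fubini for the product law. Integrability of the product has to come first, from Tonelli applied
    to [|x y|]. *)
Lemma independent_expectationM : (X : T -> R) \in Lfun P 1 -> (Y : T -> R) \in Lfun P 1 ->
  ('E_P[X \* Y] = 'E_P[X] * 'E_P[Y])%E.
Proof.
move=> /Lfun1_integrable iX /Lfun1_integrable iY.
pose g (z : R * R) := (z.1 * z.2)%:E.
have mg : measurable_fun setT g.
  by apply/measurable_EFinP/measurable_funM.
have idX : (distribution P X).-integrable setT (EFin \o id).
  by apply: integrable_pushforward => //; exact/measurable_EFinP.
have idY : (distribution P Y).-integrable setT (EFin \o id).
  by apply: integrable_pushforward => //; exact/measurable_EFinP.
have mabs : measurable_fun setT (fun y : R => `|y|%:E).
  by apply/measurable_EFinP; exact: normr_measurable.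
have mXabs (Z : {mfun T >-> R}) : measurable_fun setT (fun w => `|Z w|%:E).
  exact: (measurableT_comp mabs).
have iXY : P.-integrable setT (g \o XYpair).
  apply/integrableP; split; first exact: measurableT_comp.
  rewrite (@independent_ge0_integral (abse \o g)); [|exact: measurableT_comp|by move=> z /=].
  rewrite (eq_integral (fun w => `|X w|%:E * \int[P]_v `|Y v|%:E)%E); last first.
    move=> w _; rewrite -ge0_integralZl//.
    by apply: eq_integral => v _; rewrite /g /= normrM EFinM.
  rewrite ge0_integralZr//; last exact: integral_ge0.
  move/integrableP : iX => [_ hX]; move/integrableP : iY => [_ hY].
  by rewrite lte_mul_pinfty// ?integral_ge0// ge0_fin_numE ?integral_ge0.
have idXY : (distribution P XYpair).-integrable setT g.
  by apply: integrable_pushforward.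
have ig : (distribution P X \x distribution P Y)%E.-integrable setT g.
  apply/integrableP; split => //; move/integrableP : idXY => [_]; apply: le_lt_trans.
  rewrite le_eqVlt; apply/orP; left; apply/eqP.
  by apply: eq_measure_integral => A mA _; exact: product_distribution.
rewrite unlock.
transitivity (\int[distribution P XYpair]_z g z)%E.
  by rewrite integral_distribution.
transitivity (\int[(distribution P X \x distribution P Y)%E]_z g z)%E.
  by apply: eq_measure_integral => A mA _; exact/esym/product_distribution.
rewrite -integral12_prod_meas1// /fubini_F/=.
rewrite (eq_integral (fun x : R => x%:E * \int[distribution P Y]_y (y : R)%:E)%E); last first.
  by move=> x _; rewrite -integralZl.
have <- : (\int[distribution P X]_y (y : R)%:E = \int[P]_x (X x)%:E)%E.
  by rewrite integral_distribution//; exact/measurable_EFinP.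
have <- : (\int[distribution P Y]_y (y : R)%:E = \int[P]_x (Y x)%:E)%E.
  by rewrite integral_distribution//; exact/measurable_EFinP.
have /fineK <- : (\int[distribution P Y]_y (y : R)%:E)%E \is a fin_num.
  exact: integrable_fin_num.
by rewrite integralZr.
Qed.

End IndependentPair.

Section SameLaw.
Context d (T : measurableType d) (R : realType) (P : probability T R).
Implicit Types X Y : {mfun T >-> R}.

Lemma varianceD_independent X Y : finite_moments P X -> finite_moments P Y ->
  independent_pair P X Y -> ('V_P[(X \+ Y)%R] = 'V_P[X] + 'V_P[Y])%E.
Proof.
move=> /[dup] X1 /finite_moments_Lfun2 X2 /[dup] Y1 /finite_moments_Lfun2 Y2 iXY.
have {}X1 := finite_moments_Lfun1 X1; have {}Y1 := finite_moments_Lfun1 Y1.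
rewrite varianceD// covarianceE ?Lfun2_mul_Lfun1// independent_expectationM//.
by rewrite subee ?mule0 ?adde0// fin_numM// expectation_fin_num.
Qed.

Definition same_law X Y := forall A, measurable A -> distribution P X A = distribution P Y A.

Lemma same_law_sym X Y : same_law X Y -> same_law Y X.
Proof. by move=> XY A mA; rewrite XY. Qed.

Lemma same_law_integral X Y (g : R -> \bar R) : same_law X Y ->
  measurable_fun setT g -> (\int[P]_w g (X w) = \int[P]_w g (Y w))%E.
Proof.
move=> XY mg.
have H (f : R -> \bar R) : measurable_fun setT f -> (forall x, 0 <= f x)%E ->
    (\int[P]_w f (X w) = \int[P]_w f (Y w))%E.
  move=> mf f0; rewrite -!(ge0_integral_distribution _ mf f0).
  by apply: eq_measure_integral => A mA _; exact: XY.
rewrite integralE [RHS]integralE; congr (_ - _)%E.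
- transitivity (\int[P]_w g^\+ (X w))%E; first by apply: eq_integral => w _; rewrite !funeposE.
  rewrite H//; first by apply: eq_integral => w _; rewrite !funeposE.
  exact: measurable_funepos.
- transitivity (\int[P]_w g^\- (X w))%E; first by apply: eq_integral => w _; rewrite !funenegE.
  rewrite H//; first by apply: eq_integral => w _; rewrite !funenegE.
  exact: measurable_funeneg.
Qed.

Lemma same_law_expectation X Y (g : R -> R) : same_law X Y ->
  measurable_fun setT g -> ('E_P[g \o X] = 'E_P[g \o Y])%E.
Proof.
move=> XY mg; rewrite unlock; apply: (same_law_integral (g := EFin \o g)) => //.
exact/measurable_EFinP.
Qed.

Lemma same_law_variance X Y : same_law X Y -> ('V_P[X] = 'V_P[Y])%E.
Proof.
move=> XY; rewrite /variance unlock.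
have -> : ('E_P[X] = 'E_P[Y])%E by exact: (same_law_expectation (g := id)).
apply: (same_law_expectation (g := fun x => (x - fine 'E_P[Y]) * (x - fine 'E_P[Y]))) => //.
by apply: measurable_funM; exact: measurable_funB.
Qed.

Lemma same_law_moments X Y : same_law X Y -> finite_moments P X -> finite_moments P Y.
Proof.
move=> XY hX n; rewrite -(same_law_expectation (g := fun x => `|x| ^+ n) XY); first exact: hX.
by apply: measurable_funX; exact: normr_measurable.
Qed.

(** Used in both directions, this turns monotonicity into law invariance, so that [C] may be
    evaluated on any copy. *)
Lemma same_law_mean_preserving_spread X Y : same_law X Y ->
  mean_preserving_spread P X Y.
Proof.
move=> XY; split; first exact: (same_law_expectation (g := id)).
move=> phi _ phi_nd _ _.
rewrite (same_law_expectation XY)//.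
exact: nondecreasing_measurable.
Qed.

Lemma rich_pair (mu nu : probability R R) : rich P ->
  exists X Y : {mfun T >-> R}, [/\ independent_pair P X Y,
    (forall A, measurable A -> distribution P X A = mu A) &
    (forall A, measurable A -> distribution P Y A = nu A)].
Proof.
move=> /(_ (fun n => if n is 0 then mu else nu)) [X [indX lawX]].
exists (X 0%N), (X 1%N); split; [|exact: lawX 0%N|exact: lawX 1%N].
move=> A B mA mB.
have := indX [fset 0; 1]%fset (fun n => if n is 0 then A else B).
have -> : \bigcap_(i in [set` [fset 0; 1]%fset]) X i @^-1` (if i is 0 then A else B)
    = X 0 @^-1` A `&` X 1 @^-1` B.
  apply/seteqP; split => w /=.
    by move=> h; split; [apply: (h 0%N)|apply: (h 1%N)]; rewrite /= !inE.
  by move=> [h0 h1] [|[|n]] //=; rewrite !inE.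
rewrite big_fsetU1/= ?inE// big_seq_fset1; apply.
by case.
Qed.

End SameLaw.

(** * The noise distribution *)

Section Density.
Context (R : realType) (h : R -> R).
Notation mu := (@lebesgue_measure R).
Hypothesis mh : measurable_fun setT h.
Hypothesis h0 : forall x, 0 <= h x.
Hypothesis h1 : (\int[mu]_x (h x)%:E = 1)%E.

Let dens (A : set (measurableTypeR R)) : \bar R := (\int[mu]_(x in A) (h x)%:E)%E.

Let integrable_h : mu.-integrable setT (EFin \o h).
Proof.
apply/integrableP; split; first exact/measurable_EFinP.
by under eq_integral => x _ do rewrite /= ger0_norm//; rewrite h1 ltry.
Qed.

Let dens0 : dens set0 = 0%E.
Proof. by rewrite /dens integral_set0. Qed.

Let dens_ge0 A : (0 <= dens A)%E.
Proof. by apply: integral_ge0 => x _; rewrite lee_fin. Qed.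

Let dens_sigma_additive : semi_sigma_additive dens.
Proof.
move=> /= A mA tA mUA.
rewrite /dens/= integral_bigcup//=; last first.
  exact: (integrableS _ _ (subsetT _)).
apply: is_cvg_ereal_nneg_natsum_cond => n _ _.
by apply: integral_ge0 => /= x ?; rewrite lee_fin.
Qed.

HB.instance Definition _ := isMeasure.Build _ _ _ dens
  dens0 dens_ge0 dens_sigma_additive.

Let dens_setT : dens [set: _] = 1%E.
Proof. exact: h1. Qed.

HB.instance Definition _ := @Measure_isProbability.Build _ _ R dens dens_setT.

Let dens_dominates : dens `<< mu.
Proof.
apply/null_content_dominatesP => A mA muA0.
by apply: null_set_integral => //; exact/measurable_funTS/measurable_EFinP.
Qed.

(* [lebesgue_measure] lives on [measurableTypeR R], whose display differs from
   the one of [R]; the law on [R] is the image under the identity. *)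
Let toR : measurableTypeR R -> R := idfun.

HB.instance Definition _ := @isMeasurableFun.Build _ _ _ _ toR (@measurable_id _ _ setT).

(** Integrals against [dens] are computed through its Radon-Nikodym derivative, which equals [h]
    almost everywhere because both have the same integral over every measurable set. *)
Lemma probability_density : exists nu : probability R R,
  forall f : R -> \bar R, measurable_fun setT f -> (forall x, 0 <= f x)%E ->
    (\int[nu]_x f x = \int[mu]_x (f x * (h x)%:E))%E.
Proof.
exists (distribution dens toR) => f mf f0.
rewrite ge0_integral_distribution//.
rewrite -(Radon_Nikodym_SigmaFinite.change_of_variables dens_dominates)//.
have mRN : mu.-integrable setT (Radon_Nikodym_SigmaFinite.f dens mu).
  exact: Radon_Nikodym_SigmaFinite.f_integrable.
apply: ae_eq_integral => //.
- by apply: emeasurable_funM => //; exact: measurable_int mRN.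
- by apply: emeasurable_funM => //; exact/measurable_EFinP.
- apply: ae_eqe_mul2l; apply: integral_ae_eq => //.
  + exact/measurable_EFinP.
  + by move=> E _ mE; rewrite -Radon_Nikodym_SigmaFinite.f_integral.
Qed.

End Density.

(** * Submultiplicative weighted exponential series *)

Section WeightedExponential.
Context (R : realType) (b : nat -> R).
Hypothesis b0 : b 0 = 1.
Hypothesis b_ge0 : forall n, 0 <= b n.
Hypothesis b_submul : forall m n, b (m + n) <= b m * b n.
Hypothesis b_le1 : forall n, b n <= 1.

Definition wexp_coeff (s : R) (n : nat) : R := b n * exp_coeff s n.

(** This is the function [G], meant for [s >= 0], where the exponential series dominates it. *)
Definition wexp (s : R) : R := limn (series (wexp_coeff s)).

Lemma wexp_coeff_ge0 s n : 0 <= s -> 0 <= wexp_coeff s n.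
Proof. by move=> s0; rewrite mulr_ge0// exp_coeff_ge0. Qed.

Lemma is_cvg_wexp s : 0 <= s -> cvgn (series (wexp_coeff s)).
Proof.
move=> s0; apply: series_le_cvg (is_cvg_series_exp_coeff s).
- by move=> n; exact: wexp_coeff_ge0.
- by move=> n; exact: exp_coeff_ge0.
- by move=> n; rewrite ler_piMl ?exp_coeff_ge0.
Qed.

Lemma wexp_partial_le s n : 0 <= s -> series (wexp_coeff s) n <= wexp s.
Proof.
move=> s0; apply: nondecreasing_cvgn_le; last exact: is_cvg_wexp.
apply/nondecreasing_seqP => k.
by rewrite /series /= big_nat_recr//= lerDl wexp_coeff_ge0.
Qed.

Lemma wexp_coeff_le s n : 0 <= s -> wexp_coeff s n <= wexp s.
Proof.
move=> s0; apply: le_trans (wexp_partial_le n.+1 s0).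
by rewrite /series /= big_nat_recr//= lerDr sumr_ge0// => i _; exact: wexp_coeff_ge0.
Qed.

Lemma wexp_ge1 s : 0 <= s -> 1 <= wexp s.
Proof.
move=> s0; apply: le_trans (wexp_coeff_le 0 s0).
by rewrite /wexp_coeff b0 /exp_coeff /= expr0 fact0 divr1 mul1r.
Qed.

Lemma ler_wexp s t : 0 <= s -> s <= t -> wexp s <= wexp t.
Proof.
move=> s0 st; have t0 := le_trans s0 st.
apply: ler_lim; [exact: is_cvg_wexp|exact: is_cvg_wexp|].
apply: nearW => n; apply: ler_sum => i _.
by rewrite ler_wpM2l// /exp_coeff /= ler_wpM2r ?invr_ge0// lerXn2r.
Qed.

(** The Cauchy product of two exponential series, as an inequality: [b n <= b (n - i) * b i] bounds
    each term of the binomial expansion of [(s + t) ^+ n]. *)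
Lemma wexpD_le s t : 0 <= s -> 0 <= t -> wexp (s + t) <= wexp s * wexp t.
Proof.
move=> s0 t0; apply: limr_le; first by apply: is_cvg_wexp; rewrite addr_ge0.
apply: nearW => N.
apply: le_trans (_ : series (wexp_coeff s) N * series (wexp_coeff t) N <= _); last first.
  by rewrite ler_pM ?wexp_partial_le// sumr_ge0// => i _; exact: wexp_coeff_ge0.
(* The binomial expansions fill the triangle [i <= n < N]. Summed over [n] first, each [i]
   contributes the first [N - i] terms of the series at [s], hence no more than its partial sum up
   to [N]. *)
apply: (@le_trans _ _ (\sum_(0 <= n < N) \sum_(0 <= i < N | (i <= n)%N)
   wexp_coeff s (n - i) * wexp_coeff t i)).
  rewrite /series /= !big_nat; apply: ler_sum => n /andP[_ nN].
  rewrite (_ : \sum_(0 <= i < N | (i <= n)%N) _ =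
      \sum_(i < n.+1) wexp_coeff s (n - i) * wexp_coeff t i); last first.
    rewrite -(big_mkord xpredT (fun i => wexp_coeff s (n - i) * wexp_coeff t i)).
    by rewrite (big_nat_widen _ _ N)//; apply: eq_bigl => i; rewrite ltnS.
  rewrite {1}/wexp_coeff /exp_coeff /= exprDn mulr_suml mulr_sumr.
  apply: ler_sum => -[i/= +] _; rewrite ltnS => lein.
  rewrite /wexp_coeff /exp_coeff /=.
  have -> : s ^+ (n - i) * t ^+ i *+ 'C(n, i) / n`!%:R =
     (s ^+ (n - i) / (n - i)`!%:R) * (t ^+ i / i`!%:R).
    rewrite -(bin_fact lein) !natrM -mulr_natr.
    have := @lt0r_neq0 R i`!%:R; rewrite ltr0n fact_gt0 => /(_ isT) h1.
    have := @lt0r_neq0 R (n - i)`!%:R; rewrite ltr0n fact_gt0 => /(_ isT) h2.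
    have h3 : 'C(n, i)%:R != 0 :> R by rewrite pnatr_eq0 -lt0n bin_gt0.
    by field; rewrite h1 h2 h3.
  rewrite [leRHS]mulrACA ler_wpM2r//.
    by rewrite mulr_ge0// divr_ge0// exprn_ge0.
  by rewrite -{1}(subnK lein).
under eq_bigr do rewrite big_mkcond.
rewrite exchange_big_nat /=.
rewrite mulrC /series /= mulr_suml big_nat [leRHS]big_nat; apply: ler_sum => i /andP[_ iN].
rewrite -big_mkcond /=; under eq_bigr do rewrite mulrC.
rewrite -mulr_sumr ler_wpM2l ?wexp_coeff_ge0//.
rewrite (_ : \sum_(0 <= j < N | (i <= j)%N) _ =
    \sum_(i <= j < N) wexp_coeff s (j - i)); last first.
  by rewrite [RHS](big_nat_widenl i 0).
rewrite -{1}(add0n i) big_addn.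
under eq_bigr do rewrite addnK.
rewrite [leRHS](big_cat_nat _ (n := N - i)) ?leq_subr//= lerDl sumr_ge0// => k _.
exact: wexp_coeff_ge0.
Qed.

Lemma measurable_wexp_norm : measurable_fun setT (fun x : R => wexp `|x|).
Proof.
(* [wexp] is known to be monotone on nonnegative reals only; clamping the argument at 0 gives a
   function monotone on the whole line. *)
have m : measurable_fun setT (fun x : R => wexp (Num.max x 0)).
  apply: nondecreasing_measurable => // x y xy.
  apply: ler_wexp; first by rewrite le_max lexx orbT.
  by rewrite ge_max !le_max xy lexx orbT.
have -> : (fun x : R => wexp `|x|) = (fun x : R => wexp (Num.max x 0)) \o Num.norm.
  by apply/funext => x /=; rewrite max_l.
by apply: measurableT_comp => //; exact: normr_measurable.
Qed.

Lemma measurable_wexp_normV : measurable_fun setT (fun x : R => (wexp `|x|)^-1).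
Proof.
have -> : (fun x : R => (wexp `|x|)^-1) =
    (fun y : R => (Num.max y 1)^-1) \o (fun z : R => wexp `|z|).
  by apply/funext => z /=; rewrite max_l// wexp_ge1.
apply: measurableT_comp; last exact: measurable_wexp_norm.
have max_gt0 (y : R) : 0 < Num.max y 1 by rewrite lt_max ltr01 orbT.
apply: nonincreasing_measurable => // x y xy.
by rewrite lef_pV2 ?posrE// ge_max !le_max xy lexx orbT.
Qed.

Lemma EFin_wexp s : 0 <= s -> ((wexp s)%:E = \sum_(n <oo) (wexp_coeff s n)%:E)%E.
Proof.
move=> s0; rewrite /wexp -EFin_lim; last exact: is_cvg_wexp.
by congr (limn _); apply/funext => n /=; rewrite sumEFin.
Qed.

End WeightedExponential.

Section Weights.
Context (R : realType).

(** Take [b n] to be a product of factors [c 1, ..., c n] that are nonincreasing and at most 1. The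
    last [n] factors of [b (m + n)] are then below those of [b n], which is submultiplicativity, and
    the last factor of [b n.+1] alone absorbs [M n.+1]. *)
Lemma exists_weights (M : nat -> R) (eps : R) : (forall n, 0 <= M n) ->
  0 < eps -> eps <= 1 -> exists b : nat -> R,
  [/\ b 0 = 1, forall n, 0 < b n, forall m n, b (m + n)%N <= b m * b n,
      forall n, b n <= 1 & forall n, b n.+1 * M n.+1 <= eps].
Proof.
move=> M0 e0 e1.
(* A nondecreasing majorant of [M] that is at least 1; hence [eps / S n] is nonincreasing and at
   most 1. *)
pose S n := 1 + \sum_(i < n.+1) M i.
have S_ge1 n : 1 <= S n by rewrite lerDl sumr_ge0.
have S_nd m n : (m <= n)%N -> S m <= S n.
  move=> mn; rewrite lerD2l -!(big_mkord xpredT).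
  by rewrite [leRHS](big_cat_nat _ (n := m.+1))//= lerDl sumr_ge0.
have M_le n : M n <= S n.
  by rewrite /S big_ord_recr /= addrA lerDr addr_ge0// sumr_ge0.
have S_gt0 n : 0 < S n := lt_le_trans ltr01 (S_ge1 n).
pose c n := eps / S n.
have c_gt0 n : 0 < c n by rewrite divr_gt0.
have c_le1 n : c n <= 1.
  by rewrite ler_pdivrMr// mul1r (le_trans e1).
pose b n := \prod_(i < n) c i.+1.
have b_gt0 n : 0 < b n by apply: prodr_gt0.
have b_le1 n : b n <= 1.
  by rewrite /b prodr_ile1 // => i _; rewrite c_le1 ltW.
exists b; split => //; first by rewrite /b big_ord0.
- move=> m n; rewrite /b big_split_ord/= ler_wpM2l//; first exact/ltW/b_gt0.
  apply: ler_prod => i _; apply/andP; split; first exact/ltW/c_gt0.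
  rewrite /c ler_pM2l// lef_pV2 ?posrE//.
  by apply: S_nd; rewrite ltnS leq_addl.
- move=> n; rewrite /b big_ord_recr/= -mulrA.
  apply: (@le_trans _ _ (1 * (c n.+1 * M n.+1))).
    by rewrite ler_wpM2r ?b_le1// mulr_ge0// ltW.
  by rewrite mul1r /c mulrAC ler_pdivrMr// ler_pM2l.
Qed.

End Weights.

Section WexpIntegral.
Context d (T : measurableType d) (R : realType) (P : probability T R).
Context (b M : nat -> R) (eps : R).
Hypothesis b0 : b 0 = 1.
Hypothesis b_ge0 : forall n, 0 <= b n.
Hypothesis b_le1 : forall n, b n <= 1.
Hypothesis bM : forall n, b n.+1 * M n.+1 <= eps.
Hypothesis eps0 : 0 <= eps.

(** Expand [G] and integrate term by term. The term of index 0 is exactly the second moment since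
    [b 0 = 1]; each later one is at most [eps / n!], and these sum to at most [eps * expR 1]. *)
Lemma integral_sqr_wexp_le (X : {mfun T >-> R}) :
  (forall n, ('E_P[fun w => (`|X w| ^+ n.+2)%R] <= (M n)%:E)%E) ->
  (\int[P]_w ((X w) ^+ 2 * wexp b `|X w|)%:E <= 'E_P[(X ^+ 2)%R] + (eps * expR 1)%:E)%E.
Proof.
move=> hM.
have mX : measurable_fun setT (fun w => `|X w|).
  by apply: measurableT_comp => //; exact: normr_measurable.
have mc n : measurable_fun setT (fun w => (X w ^+ 2 * wexp_coeff b `|X w| n)%:E).
  apply/measurable_EFinP; apply: measurable_funM; first exact: measurable_funX.
  apply: measurable_funM => //; apply: measurable_funM => //.
  exact: measurable_funX.
have -> : (\int[P]_w ((X w) ^+ 2 * wexp b `|X w|)%:E =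
    \sum_(n <oo) \int[P]_w (X w ^+ 2 * wexp_coeff b `|X w| n)%:E)%E.
  rewrite -integral_nneseries//; last first.
    by move=> n w _; rewrite lee_fin mulr_ge0 ?sqr_ge0// wexp_coeff_ge0.
  apply: eq_integral => w _; rewrite EFinM EFin_wexp// -nneseriesZl//.
  by move=> n _; rewrite lee_fin wexp_coeff_ge0.
have uE n : (\int[P]_w (X w ^+ 2 * wexp_coeff b `|X w| n)%:E =
   (b n / n`!%:R)%:E * 'E_P[fun w => (`|X w| ^+ n.+2)%R])%E.
  rewrite unlock -ge0_integralZl//.
  - apply: eq_integral => w _; rewrite -EFinM; congr EFin.
    rewrite /wexp_coeff /exp_coeff /= -[X w ^+ 2]ger0_norm ?sqr_ge0// normrX.
    rewrite -[n.+2]addn2 exprD; ring.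
  - apply/measurable_EFinP; exact: measurable_funX.
  - by rewrite lee_fin divr_ge0.
have E2 : ('E_P[fun w => (`|X w| ^+ 2)%R] = 'E_P[(X ^+ 2)%R])%E.
  by congr expectation; apply/funext => w; rewrite -normrX ger0_norm// sqr_ge0.
have EX0 : (0 <= 'E_P[(X ^+ 2)%R])%E by apply: expectation_ge0 => w; exact: sqr_ge0.
apply: lime_le.
  apply: is_cvg_nneseries => n _ _; apply: integral_ge0 => w _.
  by rewrite lee_fin mulr_ge0 ?sqr_ge0// wexp_coeff_ge0.
apply: nearW => N.
apply: (@le_trans _ _ ('E_P[(X ^+ 2)%R] + (eps * series (exp_coeff 1) N)%:E)%E); last first.
  rewrite leeD2l// lee_fin ler_wpM2l//; apply: nondecreasing_cvgn_le.
    apply/nondecreasing_seqP => k.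
    by rewrite /series /= big_nat_recr//= lerDl exp_coeff_ge0.
  exact: is_cvg_series_exp_coeff.
elim: N => [|N IH].
  by rewrite big_geq// /series /= big_geq// mulr0 adde0.
rewrite big_nat_recr//.
have -> : series (exp_coeff 1) N.+1 = series (exp_coeff 1) N + exp_coeff 1 N :> R.
  by rewrite /series /= big_nat_recr.
case: N IH => [_|N IH].
  rewrite /series /= !big_geq// add0e add0r uE E2 b0 fact0 divr1 mul1e.
  by rewrite leeDl// lee_fin mulr_ge0// exp_coeff_ge0.
rewrite mulrDr EFinD addeA; apply: leeD; first exact: IH.
rewrite uE.
apply: (@le_trans _ _ ((b N.+1 / N.+1`!%:R)%:E * (M N.+1)%:E)%E).
  by rewrite lee_wpmul2l// lee_fin divr_ge0.
rewrite -EFinM lee_fin /exp_coeff /= expr1n mulrAC mul1r ler_wpM2r//.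
Qed.

End WexpIntegral.

Section Noise.
Context (R : realType) (b : nat -> R).
Notation mu := (@lebesgue_measure R).
Hypothesis b0 : b 0 = 1.
Hypothesis b_gt0 : forall n, 0 < b n.
Hypothesis b_le1 : forall n, b n <= 1.

Let b_ge0 n : 0 <= b n. Proof. exact: ltW. Qed.

Let wexp_gt0 (z : R) : 0 < wexp b `|z|.
Proof. exact: lt_le_trans ltr01 (wexp_ge1 b0 b_ge0 b_le1 (normr_ge0 z)). Qed.

Let q (z : R) := (wexp b `|z|)^-1.

Let measurable_q : measurable_fun setT q.
Proof. exact: measurable_wexp_normV. Qed.

Let q_ge0 z : 0 <= q z. Proof. by rewrite invr_ge0 ltW. Qed.

(** Every weight is positive, so a single term of the series gives [|z| ^+ k <= k! / b k * G(|z|)].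
    Using it for [k = n] and [k = n + 2] leaves the integrable factor [1 / (1 + z ^+ 2)]. *)
Let powM_q_le n : exists2 K : R, 0 <= K &
  forall z, `|z| ^+ n * q z <= K * (oneDsqr z)^-1.
Proof.
exists (n`!%:R / b n + n.+2`!%:R / b n.+2).
  by rewrite addr_ge0// divr_ge0// ltW.
move=> z; rewrite ler_pdivlMr ?ltr_pwDl ?sqr_ge0// mulrAC ler_pdivrMr//.
have H k : `|z| ^+ k <= k`!%:R / b k * wexp b `|z|.
  have := wexp_coeff_le b_ge0 b_le1 k (normr_ge0 z).
  rewrite /wexp_coeff /exp_coeff /= => h.
  rewrite mulrAC ler_pdivlMr// mulrC.
  by rewrite [leRHS]mulrC -ler_pdivrMr ?ltr0n ?fact_gt0// -mulrA.
rewrite /oneDsqr mulrDr mulr1 mulrDl lerD//.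
apply: le_trans (H n.+2); rewrite -[z ^+ 2]ger0_norm ?sqr_ge0// normrX -exprD addn2.
by [].
Qed.

Let integral_powM_q_lty n : (\int[mu]_z (`|z| ^+ n * q z)%:E < +oo)%E.
Proof.
have [K K0 hK] := powM_q_le n.
have mV : measurable_fun setT (fun z : R => (oneDsqr z)^-1).
  by apply: continuous_measurable_fun; exact: continuous_oneDsqrV.
apply: (@le_lt_trans _ _ (\int[mu]_z (K%:E * ((oneDsqr z)^-1)%:E))%E).
  apply: ge0_le_integral => //.
  - by move=> z _; rewrite lee_fin mulr_ge0// exprn_ge0.
  - apply/measurable_EFinP/measurable_funM => //.
    by apply: measurable_funX; exact: normr_measurable.
  - by apply: measurable_funeM; exact/measurable_EFinP.
  - by move=> z _; rewrite -EFinM lee_fin.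
rewrite ge0_integralZl//; last exact/measurable_EFinP.
rewrite ge0_symfun_integralT//; first last.
- by move=> z /=; rewrite /oneDsqr sqrrN.
- exact: continuous_oneDsqrV.
rewrite (_ : [set x | _] = `[0, +oo[%classic); last first.
  by apply/seteqP; split => x/=; rewrite in_itv/= andbT.
by rewrite integral0y_oneDsqr -!EFinM ltry.
Qed.

Lemma exists_noise : exists (c : R) (nu : probability R R),
  [/\ 0 < c,
    forall f : R -> \bar R, measurable_fun setT f -> (forall x, 0 <= f x)%E ->
      (\int[nu]_x f x = \int[mu]_x (f x * (c / wexp b `|x|)%:E))%E &
    forall n, (\int[nu]_x (`|x| ^+ n)%:E < +oo)%E].
Proof.
have mEq : measurable_fun setT (EFin \o q) by exact/measurable_EFinP.
have I_fin : (\int[mu]_z (q z)%:E)%E \is a fin_num.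
  rewrite ge0_fin_numE; last by apply: integral_ge0 => z _; rewrite lee_fin.
  have := integral_powM_q_lty 0.
  by under eq_integral do rewrite expr0 mul1r.
(* On [[0, 1]] the integrand is at least [1 / G(1)], since [G] is nondecreasing. *)
have I_gt0 : (0 < \int[mu]_z (q z)%:E)%E.
  apply: (@lt_le_trans _ _ (\int[mu]_(z in `[0%R, 1%R]) ((wexp b 1)^-1)%:E)%E).
    rewrite integral_cst//= lebesgue_measure_itv/= lte_fin ltr01 oppr0 adde0 mule1.
    by rewrite lte_fin invr_gt0; have := wexp_gt0 1; rewrite normr1.
  apply: (@le_trans _ _ (\int[mu]_(z in `[0%R, 1%R]) (q z)%:E)%E).
    apply: ge0_le_integral => //.
    - by move=> z _; rewrite lee_fin invr_ge0; have := ltW (wexp_gt0 1); rewrite normr1.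
    - exact: measurable_funTS.
    - move=> z /=; rewrite in_itv/= => /andP[z0 z1].
      rewrite lee_fin lef_pV2 ?posrE//; last by have := wexp_gt0 1; rewrite normr1.
      by apply: ler_wexp => //; rewrite ger0_norm.
  by apply: ge0_subset_integral => // z _; rewrite lee_fin.
pose c : R := (fine (\int[mu]_z (q z)%:E)%E)^-1.
have c_gt0 : 0 < c by rewrite invr_gt0 fine_gt0// I_gt0 ltey_eq I_fin.
have h1 : (\int[mu]_z (c * q z)%:E = 1)%E.
  under eq_integral do rewrite EFinM.
  rewrite ge0_integralZl//; last 2 first.
  - by move=> z _; rewrite lee_fin.
  - by rewrite lee_fin ltW.
  by rewrite -[X in (_ * X)%E]fineK// -EFinM mulVf// gt_eqF// -invr_gt0.
have mh : measurable_fun setT (fun z => c * q z) by exact: measurable_funM.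
have h0 z : 0 <= c * q z by rewrite mulr_ge0// ltW.
have [nu nuE] := probability_density mh h0 h1.
exists c, nu; split => // n.
have mn : measurable_fun setT (fun z : R => `|z| ^+ n).
  by apply: measurable_funX; exact: normr_measurable.
rewrite nuE; last 2 first.
- exact/measurable_EFinP.
- by move=> x; rewrite lee_fin exprn_ge0.
under eq_integral do rewrite -EFinM mulrCA EFinM.
rewrite ge0_integralZl//.
- by rewrite lte_mul_pinfty// lee_fin ltW.
- exact/measurable_EFinP/measurable_funM.
- by move=> z _; rewrite lee_fin mulr_ge0// exprn_ge0.
- by rewrite lee_fin ltW.
Qed.

End Noise.

(** * Second-order expansion under noise *)

Section Remainder.
Context (R : realType).
Notation mu := (@lebesgue_measure R).

Lemma integral_affine (a b p q : R) : a < b ->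
  (\int[mu]_(z in `[a, b]) (p * z + q)%:E =
   (p / 2 * (b ^+ 2 - a ^+ 2) + q * (b - a))%:E)%E.
Proof.
move=> ab.
pose F (z : R) : R := p / 2 * z ^+ 2 + q * z.
have dF (z : R) : is_derive z 1 F (p * z + q).
  by apply: is_derive_eq; rewrite /GRing.scale /=; field.
have cF : continuous F.
  move=> z; apply: differentiable_continuous; apply/derivable1_diffP.
  exact: (ex_derive (is_derive := dF z)).
rewrite (@continuous_FTC2 R (fun z => p * z + q) F a b)//.
- by rewrite -EFinB /F; congr EFin; ring.
- apply: continuous_subspaceT => z.
  by apply: cvgD; [apply: cvgM; [exact: cvg_cst|exact: cvg_id]|exact: cvg_cst].
- split.
  + by move=> z _; exact: (ex_derive (is_derive := dF z)).
  + by apply: cvg_at_right_filter; exact: cF.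
  + by apply: cvg_at_left_filter; exact: cF.
- by move=> z _; rewrite derive1E; exact: (derive_val (is_derive := dF z)).
Qed.

(* The error of the first-order expansion of [x |-> (u - x)^+] at [0]; it
   vanishes unless [u] lies between [0] and [x]. *)
Definition remainder (x u : R) : R :=
  Num.max (u - x) 0 - Num.max u 0 + (if 0 < u then x else 0).

(** By convexity, [x |-> (u - x)^+] lies above its supporting line at 0. *)
Lemma remainder_ge0 x u : 0 <= remainder x u.
Proof.
rewrite /remainder.
case: (ltP 0 u) => u0; case: (leP (u - x) 0) => ux; rewrite /=; lra.
Qed.

Lemma remainder_eq0 x u : `|x| < `|u| -> remainder x u = 0.
Proof.
rewrite /remainder.
case: (ltP 0 u) => u0; case: (leP (u - x) 0) => ux; case: (ger0P x) => x0;
  rewrite ?(ger0_norm (ltW u0)) ?(ler0_norm u0) /=; lra.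
Qed.

Lemma remainder_le x u : remainder x u <= `|x|.
Proof.
rewrite /remainder.
case: (ltP 0 u) => u0; case: (leP (u - x) 0) => ux; case: (ger0P x) => x0; rewrite /=; lra.
Qed.

Lemma measurable_remainder x : measurable_fun setT (remainder x).
Proof.
apply: measurable_funD; first apply: measurable_funB.
- by apply: measurable_maxr => //; exact: measurable_funB.
- exact: measurable_maxr.
- by apply: measurable_fun_ifT => //; exact: measurable_fun_ltr.
Qed.

(** As a function of [z], the graph bounds a right triangle with both legs of length [|x|], to the
    left of [t] if [x > 0] and to its right if [x < 0]. *)
Lemma integral_remainder x t :
  (\int[mu]_z (remainder x (t - z))%:E = (x ^+ 2 / 2)%:E)%E.
Proof.
(* The half-open interval fits both signs of [x]: by the convention [0 < u], the remainder vanishes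
   at [z = t] when [x > 0], but equals [|x|] there when [x < 0]. *)
have E (a b p q : R) : a < b ->
  (forall z, remainder x (t - z) = if (a <= z < b) then p * z + q else 0) ->
  (\int[mu]_z (remainder x (t - z))%:E = (p / 2 * (b ^+ 2 - a ^+ 2) + q * (b - a))%:E)%E.
  move=> ab h; rewrite -integral_affine// -integral_itv_bndo_bndc; last first.
    apply/measurable_EFinP; apply: measurable_funD => //; exact: measurable_funM.
  rewrite [RHS]integral_mkcond; apply: eq_integral => z _.
  by rewrite h patchE mem_setE in_itv/=; case: ifP.
have [x0|x0|->] := ltgtP x 0.
- rewrite (E t (t - x) (-1) (t - x)); [by congr EFin; field|lra|].
  move=> z; rewrite /remainder; case: (ltP 0 (t - z)) => u0;
    case: (leP (t - z - x) 0) => ux; case: ifP => /=; lra.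
- rewrite (E (t - x) t 1 (x - t)); [by congr EFin; field|lra|].
  move=> z; rewrite /remainder; case: (ltP 0 (t - z)) => u0;
    case: (leP (t - z - x) 0) => ux; case: ifP => /=; lra.
- rewrite expr0n/= mul0r; apply: integral0_eq => z _.
  by rewrite /remainder subr0 subrr add0r; case: ifP.
Qed.

End Remainder.

Section NoiseExpansion.
Context (R : realType) (b : nat -> R) (c : R) (nu : probability R R).
Notation mu := (@lebesgue_measure R).
Hypothesis b0 : b 0 = 1.
Hypothesis b_ge0 : forall n, 0 <= b n.
Hypothesis b_submul : forall m n, b (m + n) <= b m * b n.
Hypothesis b_le1 : forall n, b n <= 1.
Hypothesis c_gt0 : 0 < c.
Hypothesis nuE : forall f : R -> \bar R, measurable_fun setT f ->
  (forall x, 0 <= f x)%E ->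
  (\int[nu]_x f x = \int[mu]_x (f x * (c / wexp b `|x|)%:E))%E.
Hypothesis nu1 : (\int[nu]_x (`|x|)%:E < +oo)%E.

Let G_ge1 (z : R) : 1 <= wexp b `|z|. Proof. exact: wexp_ge1. Qed.

Let G_gt0 (z : R) : 0 < wexp b `|z|. Proof. exact: lt_le_trans ltr01 (G_ge1 z). Qed.

Let h (z : R) := c / wexp b `|z|.

Let h_ge0 z : 0 <= h z. Proof. by rewrite divr_ge0// ltW. Qed.

Let G_triangle (x y z : R) : `|x - y| <= `|z| ->
  wexp b `|x| <= wexp b `|y| * wexp b `|z|.
Proof.
move=> xyz; apply: (@le_trans _ _ (wexp b (`|y| + `|z|))); last exact: wexpD_le.
apply: ler_wexp => //; rewrite -{1}(subrK y x) addrC.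
by apply: le_trans (ler_normD _ _) _; rewrite lerD2l.
Qed.

(** A Harnack-type estimate: by submultiplicativity of [G], the density changes over a distance
    [|x|] by a factor of at most [G(|x|)]. Exchanging [t] and [z] gives the lower bound. *)
Let h_le (x t z : R) : `|t - z| <= `|x| -> h z <= h t * wexp b `|x|.
Proof.
move=> tzx; rewrite /h [leRHS]mulrAC ler_pdivlMr// mulrAC ler_pdivrMr//.
by rewrite -mulrA ler_pM2l// mulrC; apply: G_triangle.
Qed.

Let le_h (x t z : R) : `|t - z| <= `|x| -> h t / wexp b `|x| <= h z.
Proof.
by move=> tzx; rewrite ler_pdivrMr//; apply: h_le; rewrite distrC.
Qed.

Let integrable_le (f : R -> R) (p q : R) : measurable_fun setT f ->
  (forall z, `|f z| <= p + q * `|z|) -> nu.-integrable setT (EFin \o f).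
Proof.
move=> mf fpq.
have mn : measurable_fun setT (fun z : R => `|z|%:E).
  by apply/measurable_EFinP; exact: normr_measurable.
have : nu.-integrable setT (EFin \o cst p \+ (fun z => q%:E * (`|z|)%:E))%E.
  apply: integrableD => //; first exact: finite_measure_integrable_cst.
  apply: integrableZl => //; apply/integrableP; split => //.
  by under eq_integral do rewrite gee0_abs ?lee_fin//.
apply: le_integrable => //; first exact/measurable_EFinP.
move=> z _ /=; rewrite lee_fin.
exact: le_trans (fpq z) (ler_norm _).
Qed.

Let measurable_remainder_sub x t : measurable_fun setT (fun z : R => remainder x (t - z)).
Proof.
apply: (measurableT_comp (measurable_remainder x)).
exact: measurable_funB.
Qed.

Let integral_remainder_nu x t :
  (\int[nu]_z (remainder x (t - z))%:E = \int[mu]_z (remainder x (t - z) * h z)%:E)%E.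
Proof.
rewrite nuE.
- by apply: eq_integral => z _; rewrite EFinM.
- exact/measurable_EFinP.
- by move=> z; rewrite lee_fin remainder_ge0.
Qed.

Let measurable_h : measurable_fun setT h.
Proof. by apply: measurable_funM => //; exact: measurable_wexp_normV. Qed.

Let measurable_EFin_remainder x t :
  measurable_fun setT (fun z : R => (remainder x (t - z))%:E).
Proof. exact/measurable_EFinP. Qed.

Let measurable_remainder_h x t :
  measurable_fun setT (fun z : R => (remainder x (t - z) * h z)%:E).
Proof. by apply/measurable_EFinP; exact: measurable_funM. Qed.

(** The remainder vanishes for [|t - z| > |x|]; elsewhere [h z] may be replaced by [h t] at the cost
    of a factor [G(|x|)], and the Lebesgue integral of the remainder is known. *)
Let remainder_nu_le x t :
  (\int[nu]_z (remainder x (t - z))%:E <= (h t / 2 * (x ^+ 2 * wexp b `|x|))%:E)%E.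
Proof.
rewrite integral_remainder_nu.
apply: (@le_trans _ _ (\int[mu]_z ((h t * wexp b `|x|)%:E * (remainder x (t - z))%:E))%E).
  apply: ge0_le_integral => //.
  - by move=> z _; rewrite lee_fin mulr_ge0// remainder_ge0.
  - exact: measurable_remainder_h.
  - by apply: measurable_funeM; exact: measurable_EFin_remainder.
  - move=> z _; rewrite -EFinM lee_fin.
    have [xtz|tzx] := ltP `|x| `|t - z|.
      by rewrite remainder_eq0// mul0r mulr0.
    by rewrite mulrC ler_wpM2r ?remainder_ge0// h_le.
rewrite ge0_integralZl//.
- by rewrite integral_remainder -EFinM lee_fin le_eqVlt; apply/orP; left; apply/eqP; field.
- exact: measurable_EFin_remainder.
- by move=> z _; rewrite lee_fin remainder_ge0.
- by rewrite lee_fin mulr_ge0// ltW.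
Qed.

Let remainder_nu_ge x t :
  ((h t / 2 * (2 * x ^+ 2 - x ^+ 2 * wexp b `|x|))%:E <= \int[nu]_z (remainder x (t - z))%:E)%E.
Proof.
rewrite integral_remainder_nu.
apply: (@le_trans _ _ (\int[mu]_z ((h t / wexp b `|x|)%:E * (remainder x (t - z))%:E))%E).
  rewrite ge0_integralZl//.
  - rewrite integral_remainder -EFinM lee_fin.
    have -> : h t / wexp b `|x| * (x ^+ 2 / 2) = h t / 2 * (x ^+ 2 / wexp b `|x|).
      by field; rewrite gt_eqF.
    apply: ler_wpM2l; first exact: divr_ge0 (h_ge0 t) (ler0n _ 2).
    (* [1 / G >= 2 - G] makes the bound linear in [G]. *)
    rewrite -subr_ge0.
    have -> : x ^+ 2 / wexp b `|x| - (2 * x ^+ 2 - x ^+ 2 * wexp b `|x|) =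
      x ^+ 2 * (1 - wexp b `|x|) ^+ 2 / wexp b `|x|.
      by field; rewrite gt_eqF.
    by apply: divr_ge0; [apply: mulr_ge0; exact: sqr_ge0|exact: ltW].
  - exact: measurable_EFin_remainder.
  - by move=> z _; rewrite lee_fin remainder_ge0.
  - by rewrite lee_fin; apply: divr_ge0; [exact: h_ge0|exact: ltW].
apply: ge0_le_integral => //.
- move=> z _; rewrite -EFinM lee_fin mulr_ge0 ?remainder_ge0//.
  by apply: divr_ge0; [exact: h_ge0|exact: ltW].
- by apply: measurable_funeM; exact: measurable_EFin_remainder.
- exact: measurable_remainder_h.
- move=> z _; rewrite -EFinM lee_fin.
  have [xtz|tzx] := ltP `|x| `|t - z|.
    by rewrite remainder_eq0// mul0r mulr0.
  by rewrite mulrC ler_wpM2l ?remainder_ge0// le_h.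
Qed.

(** Here [A] is the mean of [(t - Z)^+], [p] the probability of [Z < t], and [k = h t / 2]. None
    depends on [x], so averaging over a centered variable removes the linear term. Both bounds are
    linear in [G] because only [E[X^2 G(|X|)]] is controlled. *)
Lemma noise_expansion t : exists A p k : R, 0 <= k /\ forall x,
  ((A - x * p + k * (2 * x ^+ 2 - x ^+ 2 * wexp b `|x|))%:E
    <= \int[nu]_z (Num.max (t - (x + z)) 0)%:E
    <= (A - x * p + k * (x ^+ 2 * wexp b `|x|))%:E)%E.
Proof.
pose ind (z : R) : R := if 0 < t - z then 1 else 0.
have mtz : measurable_fun setT (fun z : R => t - z) by exact: measurable_funB.
have mind : measurable_fun setT ind.
  by apply: measurable_fun_ifT => //; exact: measurable_fun_ltr.
have iA : nu.-integrable setT (EFin \o (fun z : R => Num.max (t - z) 0)).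
  apply: (@integrable_le _ `|t| 1); first exact: measurable_maxr.
  move=> z; rewrite mul1r; have := ler_normB t z.
  case: (leP (t - z) 0) => _; last by [].
  by rewrite normr0 addr_ge0.
have iI : nu.-integrable setT (EFin \o ind).
  apply: (@integrable_le _ 1 0) => // z; rewrite mul0r addr0 /ind.
  by case: ifP; rewrite ?normr1 ?normr0.
have AE := fineK (integrable_fin_num measurableT iA).
have pE := fineK (integrable_fin_num measurableT iI).
exists (fine (\int[nu]_z (Num.max (t - z) 0)%:E)%E), (fine (\int[nu]_z (ind z)%:E)%E), (h t / 2).
split; first by rewrite divr_ge0.
move=> x.
have iR : nu.-integrable setT (EFin \o (fun z : R => remainder x (t - z))).
  apply: (@integrable_le _ `|x| 0) => // z.
  by rewrite mul0r addr0 ger0_norm ?remainder_ge0// remainder_le.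
have -> : (\int[nu]_z (Num.max (t - (x + z)) 0)%:E =
   \int[nu]_z (Num.max (t - z) 0)%:E - x%:E * \int[nu]_z (ind z)%:E
   + \int[nu]_z (remainder x (t - z))%:E)%E.
  rewrite -integralZl// -integralB//; last exact: integrableZl.
  rewrite -integralD//; last by apply: integrableB => //; exact: integrableZl.
  apply: eq_integral => z _ /=; congr EFin.
  rewrite /remainder /ind opprD addrA addrAC.
  by case: ifP => _; ring.
have <- : ((fine (\int[nu]_z (Num.max (t - z) 0)%:E)%E
      - x * fine (\int[nu]_z (ind z)%:E)%E)%:E =
    \int[nu]_z (Num.max (t - z) 0)%:E - x%:E * \int[nu]_z (ind z)%:E)%E.
  by rewrite EFinB EFinM AE pE.
by apply/andP; split; [rewrite EFinD|rewrite [leRHS]EFinD]; exact: leeD2l.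
Qed.

End NoiseExpansion.

Section NoisyAngle.
Context d (T : measurableType d) (R : realType) (P : probability T R).
Context (nu : probability R R) (G : R -> R).
Hypothesis mG : measurable_fun setT (fun x : R => G x).
Hypothesis G_ge0 : forall x, 0 <= G x.

Lemma noisy_angle_bounds (X Z : {mfun T >-> R}) (t A p k e : R) :
  0 <= k ->
  (forall x, ((A - x * p + k * (2 * x ^+ 2 - x ^+ 2 * G x))%:E
    <= \int[nu]_z (Num.max (t - (x + z)) 0)%:E
    <= (A - x * p + k * (x ^+ 2 * G x))%:E)%E) ->
  independent_pair P X Z ->
  (forall B, measurable B -> distribution P Z B = nu B) ->
  finite_moments P X -> ('E_P[X] = 0)%E ->
  (\int[P]_w ((X w) ^+ 2 * G (X w))%:E <= 'E_P[(X ^+ 2)%R] + e%:E)%E ->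
  ((A%:E + k%:E * ('E_P[(X ^+ 2)%R] - e%:E)
    <= \int[P]_w (Num.max (t - (X w + Z w)) 0)%:E
    <= A%:E + k%:E * ('E_P[(X ^+ 2)%R] + e%:E))%E).
Proof.
move=> k0 bnd indXZ lawZ momX EX0 hG.
have iX : P.-integrable setT (EFin \o X) by exact/Lfun1_integrable/finite_moments_Lfun1.
have iX2 : P.-integrable setT (EFin \o (fun w => X w ^+ 2)).
  exact: Lfun2_integrable_sqr (finite_moments_Lfun2 momX).
have E2E : ('E_P[(X ^+ 2)%R] = \int[P]_w (X w ^+ 2)%:E)%E by rewrite unlock.
have fin2 : (\int[P]_w (X w ^+ 2)%:E)%E \is a fin_num := integrable_fin_num measurableT iX2.
rewrite E2E in hG *.
have iG : P.-integrable setT (EFin \o (fun w => X w ^+ 2 * G (X w))).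
  apply/integrableP; split.
    apply/measurable_EFinP; apply: measurable_funM; first exact: measurable_funX.
    exact: measurableT_comp mG _.
  rewrite (eq_integral (fun w => (X w ^+ 2 * G (X w))%:E)); last first.
    by move=> w _; rewrite gee0_abs// lee_fin mulr_ge0// sqr_ge0.
  apply: le_lt_trans hG _; rewrite -(fineK fin2) -EFinD; exact: ltry.
have finG := integrable_fin_num measurableT iG.
have icst : P.-integrable setT (EFin \o cst A) by exact: finite_measure_integrable_cst.
have iXp : P.-integrable setT (fun w => (- p)%:E * (X w)%:E)%E by exact: integrableZl.
pose g (z : R * R) : \bar R := (Num.max (t - (z.1 + z.2)) 0)%:E.
have mg : measurable_fun setT g.
  apply/measurable_EFinP; apply: measurable_maxr => //; apply: measurable_funB => //.
  exact: measurable_funD.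
have g0 z : (0 <= g z)%E by rewrite lee_fin le_max lexx orbT.
(* The average over the noise alone, which is the quantity that the expansion brackets; independence
   reduces the joint expectation to that of [F (X w)]. *)
pose F x := (\int[nu]_z g (x, z))%E.
have mF : measurable_fun setT F by exact: measurable_fun_fubini_tonelli_F.
have -> : (\int[P]_w (Num.max (t - (X w + Z w)) 0)%:E = \int[P]_w F (X w))%E.
  rewrite (independent_ge0_integral indXZ mg g0); apply: eq_integral => w _.
  rewrite -(ge0_integral_distribution Z (f := fun z => g (X w, z)))//.
    by apply: eq_measure_integral => B mB _; exact: lawZ.
  by apply: measurableT_comp => //; exact: measurable_fun_pair.
have iU : P.-integrable setT (EFin \o cst A \+ (fun w => (- p)%:E * (X w)%:E) \+
    (fun w => k%:E * (X w ^+ 2 * G (X w))%:E))%E.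
  by apply: integrableD => //; [exact: integrableD|exact: integrableZl].
have iD : P.-integrable setT (fun w => (2%:E * (X w ^+ 2)%:E) - (X w ^+ 2 * G (X w))%:E)%E.
  by apply: integrableB => //; exact: integrableZl.
have iL : P.-integrable setT (EFin \o cst A \+ (fun w => (- p)%:E * (X w)%:E) \+
    (fun w => k%:E * ((2%:E * (X w ^+ 2)%:E) - (X w ^+ 2 * G (X w))%:E)))%E.
  by apply: integrableD => //; [exact: integrableD|exact: integrableZl].
have iF : P.-integrable setT (fun w => F (X w)).
  apply: le_integrable iU => //; first exact: measurableT_comp.
  move=> w _; rewrite gee0_abs; last by apply: integral_ge0 => z _.
  have /andP[_ h] := bnd (X w).
  apply: le_trans (lee_abs _); apply: le_trans h _; rewrite /= lee_fin.
  by rewrite le_eqVlt; apply/orP; left; apply/eqP; ring.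
have iAX : P.-integrable setT (EFin \o cst A \+ (fun w => (- p)%:E * (X w)%:E))%E.
  exact: integrableD.
have EX0' : (\int[P]_w (X w)%:E = 0)%E by rewrite -EX0 unlock.
have EAX : (\int[P]_w ((EFin \o cst A \+ (fun w => (- p)%:E * (X w)%:E)) w) = A%:E)%E.
  rewrite integralD// integralZl// EX0' mule0 adde0.
  by have := expectation_cst P A; rewrite unlock.
apply/andP; split.
- apply: (@le_trans _ _ (\int[P]_w ((EFin \o cst A \+ (fun w => (- p)%:E * (X w)%:E) \+
    (fun w => k%:E * ((2%:E * (X w ^+ 2)%:E) - (X w ^+ 2 * G (X w))%:E))) w))%E).
    rewrite integralD//; last exact: integrableZl.
    rewrite EAX leeD2l// integralZl// lee_wpmul2l// ?lee_fin//.
    rewrite integralB//; last exact: integrableZl.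
    rewrite integralZl//.
    (* The lower bound comes out as [2 E[X^2] - (E[X^2] + e) = E[X^2] - e]. *)
    move: hG; rewrite -(fineK fin2) -(fineK finG) -EFinD -EFinM -!EFinB !lee_fin => hG.
    lra.
  apply: le_integral => // w _.
  have /andP[h _] := bnd (X w).
  apply: le_trans h; rewrite /= lee_fin.
  by rewrite le_eqVlt; apply/orP; left; apply/eqP; ring.
- apply: (@le_trans _ _ (\int[P]_w ((EFin \o cst A \+ (fun w => (- p)%:E * (X w)%:E) \+
    (fun w => k%:E * (X w ^+ 2 * G (X w))%:E)) w))%E).
    apply: le_integral => // w _.
    have /andP[_ h] := bnd (X w).
    apply: le_trans h _; rewrite /= lee_fin.
    by rewrite le_eqVlt; apply/orP; left; apply/eqP; ring.
  rewrite integralD//; last exact: integrableZl.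
  by rewrite EAX leeD2l// integralZl// lee_wpmul2l// lee_fin.
Qed.

End NoisyAngle.

(** * From angle functions to concave functions *)

Section Interpolation.
Context (R : realType) (phi : R -> R).
Hypothesis phi_concave : concave phi.
Hypothesis phi_nd : {homo phi : x y / x <= y}.

(** Concavity with denominators cleared, so that degenerate triples are allowed and later uses are
    linear arithmetic. *)
Lemma concave_chord (x y z : R) : x <= y -> y <= z ->
  (z - y) * phi x + (y - x) * phi z <= (z - x) * phi y.
Proof.
move=> xy yz.
have [xz|] := ltP x z; last first.
  move=> zx; have -> : x = y by apply/le_anti; rewrite xy (le_trans yz).
  have -> : z = y by apply/le_anti; rewrite yz (le_trans zx).
  by rewrite subrr !mul0r addr0.
have zx0 : 0 < z - x by rewrite subr_gt0.
have t01 : 0 <= (z - y) / (z - x) <= 1.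
  by rewrite divr_ge0 ?subr_ge0//= ?ler_pdivrMr// ?mul1r ?lerB// ltW.
have := phi_concave x z t01.
have -> : (z - y) / (z - x) * x + (1 - (z - y) / (z - x)) * z = y.
  by field; rewrite gt_eqF.
rewrite -(ler_pM2l zx0); apply: le_trans.
rewrite le_eqVlt; apply/orP; left; apply/eqP.
by field; rewrite gt_eqF.
Qed.

(** To the right of 0 the slopes are at most that of the chord over [[-1, 0]]; to the left
    monotonicity suffices. An integrable variable thus has an integrable upper bound for its image
    under [phi]. *)
Lemma concave_ub (x : R) : phi x <= phi 0 + (phi 0 - phi (- 1)) * `|x|.
Proof.
have s0 : 0 <= phi 0 - phi (- 1) by rewrite subr_ge0 phi_nd// lerN10.
have [x0|x0] := leP x 0.
  by apply: le_trans (phi_nd x0) _; rewrite lerDl mulr_ge0.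
have := @concave_chord (- 1) 0 x (lerN10 _) (ltW x0).
by rewrite gtr0_norm//; lra.
Qed.

Lemma concave_increment (x e : R) : 0 <= e ->
  phi (x + e) <= phi x + e * (phi x - phi (x - 1)).
Proof.
move=> e0; have := @concave_chord (x - 1) x (x + e).
by rewrite lerBlDl lerDr ler01 lerDl e0 => /(_ isT isT); lra.
Qed.

Variables (m : nat) (e : R).
Hypothesis e_gt0 : 0 < e.

(** Nodes are numbered from right to left. Slopes of a concave function then increase with the
    index, and each further node subtracts a nonnegative multiple of an angle function
    [(node - x)^+]. *)
Definition node (j : nat) : R := (m%:R - j%:R) * e.

Definition slope (j : nat) : R := (phi (node j + e) - phi (node j)) / e.

(* The polygonal interpolation of [phi (_ + e)] at the first [n] nodes,
   extended linearly on both sides; the shift by [e] puts it above [phi]. *)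
Definition interpolation (n : nat) (x : R) : R :=
  phi (node 0 + e) + slope 0 * (x - node 0) -
  \sum_(j < n) (slope j.+1 - slope j) * Num.max (node j.+1 - x) 0.

Lemma nodeS j : node j.+1 = node j - e.
Proof. by rewrite /node -natr1; ring. Qed.

Lemma slope_ge0 j : 0 <= slope j.
Proof.
by apply: divr_ge0; [rewrite subr_ge0 phi_nd// lerDl ltW|exact: ltW].
Qed.

Lemma slopeM j : slope j * e = phi (node j + e) - phi (node j).
Proof. by rewrite /slope divfK// gt_eqF. Qed.

Lemma slope_nd j : slope j <= slope j.+1.
Proof.
rewrite -(ler_pM2r e_gt0) !slopeM nodeS subrK.
have := @concave_chord (node j - e) (node j) (node j + e).
rewrite lerBlDl lerDr lerDl !(ltW e_gt0) => /(_ isT isT) h.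
rewrite -(ler_pM2l e_gt0); lra.
Qed.

Lemma interpolation0 x : interpolation 0 x =
  phi (node 0 + e) - slope 0 * node 0 + slope 0 * x.
Proof. by rewrite /interpolation big_ord0; ring. Qed.

Lemma interpolationS n x : interpolation n.+1 x =
  interpolation n x - (slope n.+1 - slope n) * Num.max (node n.+1 - x) 0.
Proof. by rewrite /interpolation big_ord_recr/= opprD addrA. Qed.

(** To the left of [node n] all [n] angle terms are active, and their coefficients telescope to
    [slope n]. *)
Lemma interpolation_left n x : x <= node n ->
  interpolation n x = phi (node n + e) + slope n * (x - node n).
Proof.
elim: n => [|n IH] xn; first by rewrite /interpolation big_ord0 subr0.
have xn' : x <= node n by rewrite (le_trans xn)// nodeS lerBlDr lerDl ltW.
rewrite interpolationS IH// max_l ?subr_ge0//.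
have := slopeM n; rewrite nodeS subrK => h.
have -> : phi (node n + e) = slope n * e + phi (node n) by rewrite h subrK.
ring.
Qed.

(** On this segment the interpolation increases from [phi (node n)] to [phi (node n + e)], while
    [x <= node n <= x + e]. *)
Lemma interpolation_segment n x : node n.+1 <= x -> x <= node n ->
  phi x <= interpolation n x <= phi (x + 2 * e).
Proof.
rewrite nodeS => nx xn; rewrite interpolation_left//.
have s0 := slope_ge0 n.
apply/andP; split.
  apply: le_trans (phi_nd xn) _.
  have -> : phi (node n + e) = slope n * e + phi (node n) by rewrite slopeM subrK.
  have : 0 <= slope n * (e + (x - node n)) by rewrite mulr_ge0//; lra.
  by lra.
apply: (@le_trans _ _ (phi (node n + e))).
  by rewrite gerDl mulr_ge0_le0// subr_le0.
by apply: phi_nd; lra.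
Qed.

Lemma interpolation_right n x : node n.+1 <= x -> interpolation n.+1 x = interpolation n x.
Proof. by move=> nx; rewrite interpolationS max_r ?mulr0 ?subr0// subr_le0. Qed.

Lemma interpolation_right0 n x : node 0 <= x ->
  interpolation n x = phi (node 0 + e) + slope 0 * (x - node 0).
Proof.
move=> x0; elim: n => [|n IH]; first by rewrite /interpolation big_ord0 subr0.
rewrite interpolation_right// (le_trans _ x0)// /node.
by apply: ler_wpM2r; [exact: ltW|rewrite lerB// ler_nat].
Qed.

Lemma interpolation_middle n x : node n.+1 <= x -> x <= node 0 ->
  phi x <= interpolation n x <= phi (x + 2 * e).
Proof.
elim: n => [|n IH] nx x0; first exact: interpolation_segment.
have [xn|/ltW xn] := leP x (node n.+1); first exact: interpolation_segment.
by rewrite interpolation_right// IH.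
Qed.

(** Beyond the end nodes the interpolation continues a chord of [phi (_ + e)], and a concave
    function lies below its extended chords. *)
Lemma interpolation_ge n x : phi x <= interpolation n x.
Proof.
have [x0|x0] := leP (node 0) x.
  rewrite interpolation_right0//.
  apply: (@le_trans _ _ (phi (x + e))); first by rewrite phi_nd// lerDl ltW.
  have := @concave_chord (node 0) (node 0 + e) (x + e).
  rewrite lerDl lerD2r ltW// x0 => /(_ isT isT) h.
  rewrite -(ler_pM2l e_gt0).
  have := slopeM 0 => h'.
  have -> : e * (phi (node 0 + e) + slope 0 * (x - node 0)) =
    e * phi (node 0 + e) + (slope 0 * e) * (x - node 0) by ring.
  rewrite h'; lra.
have [nx|xn] := leP (node n.+1) x.
  by have /andP[] := interpolation_middle nx (ltW x0).
have xn' : x <= node n by rewrite (le_trans (ltW xn))// nodeS lerBlDr lerDl ltW.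
rewrite interpolation_left//.
apply: (@le_trans _ _ (phi (x + e))); first by rewrite phi_nd// lerDl ltW.
have xe : x + e <= node n by rewrite nodeS in xn; lra.
have := @concave_chord (x + e) (node n) (node n + e) xe.
rewrite lerDl ltW// => /(_ isT) h.
rewrite -(ler_pM2l e_gt0).
have := slopeM n => h'.
have -> : e * (phi (node n + e) + slope n * (x - node n)) =
  e * phi (node n + e) + (slope n * e) * (x - node n) by ring.
rewrite h'; lra.
Qed.

(** The bound depends on neither the grid nor [n], which gives one integrable majorant for all the
    approximations. *)
Lemma interpolation_le n x : e <= 1 -> 0 <= node 0 -> node n + e <= 0 ->
  interpolation n x <= phi 0 + (phi 0 - phi (- 1)) * (`|x| + 2).
Proof.
move=> e1 n0 nn.
have s0 : 0 <= phi 0 - phi (- 1) by rewrite subr_ge0 phi_nd// lerN10.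
have [x0|x0] := leP (node 0) x.
  rewrite interpolation_right0//.
  set a := node 0 in n0 x0 *.
  (* The slope over [[a, a + e]] is at most that of the chord from [-1] to [a], which [concave_ub]
     at [a] bounds by that of the chord from [-1] to 0. *)
  have sl : slope 0 <= phi 0 - phi (- 1).
    rewrite ler_pdivrMr// -(@ler_pM2l _ (a + 1)) ?ltr_wpDl//.
    have := @concave_chord (- 1) a (a + e).
    rewrite (le_trans (lerN10 _) n0) lerDl ltW// => /(_ isT isT) h.
    have := concave_ub a; rewrite ger0_norm// => h'.
    have : e * phi a <= e * (phi 0 + (phi 0 - phi (-1)) * a) by rewrite ler_wpM2l// ltW.
    by lra.
  apply: (@le_trans _ _ (phi 0 + (phi 0 - phi (-1)) * (a + e) + (phi 0 - phi (-1)) * (x - a))).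
    apply: lerD; last by rewrite ler_wpM2r// subr_ge0.
    by apply: le_trans (concave_ub _) _; rewrite ger0_norm// addr_ge0// ltW.
  rewrite -addrA lerD2l -mulrDr ler_wpM2l// (ger0_norm (le_trans n0 x0)).
  by lra.
have [nx|xn] := leP (node n.+1) x.
  have /andP[_ h] := interpolation_middle nx (ltW x0).
  apply: le_trans h _; apply: le_trans (concave_ub _) _.
  rewrite lerD2l ler_wpM2l// (le_trans (ler_normD _ _))// lerD2l.
  by have e0 := ltW e_gt0; rewrite ger0_norm ?mulr_ge0//; lra.
have xn' : x <= node n by rewrite (le_trans (ltW xn))// nodeS lerBlDr lerDl ltW.
rewrite interpolation_left//.
apply: (@le_trans _ _ (phi (node n + e))).
  by rewrite gerDl mulr_ge0_le0 ?slope_ge0// subr_le0.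
apply: le_trans (phi_nd nn) _.
by rewrite lerDl mulr_ge0// addr_ge0.
Qed.

End Interpolation.

Section AngleFunctions.
Context d (T : measurableType d) (R : realType) (P : probability T R).
Variables (U V : {mfun T >-> R}).
Hypothesis iU : P.-integrable setT (EFin \o U).
Hypothesis iV : P.-integrable setT (EFin \o V).
Hypothesis EUV : (\int[P]_w (U w)%:E = \int[P]_w (V w)%:E)%E.
Hypothesis angle : forall t, (\int[P]_w (Num.max (t - V w) 0)%:E
  <= \int[P]_w (Num.max (t - U w) 0)%:E)%E.

Let icst (a : R) : P.-integrable setT (EFin \o cst a).
Proof. exact: finite_measure_integrable_cst. Qed.

Let integrable_affine (X : {mfun T >-> R}) (a s : R) : P.-integrable setT (EFin \o X) ->
  P.-integrable setT (EFin \o (fun w => a + s * X w)).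
Proof.
move=> iX; have : P.-integrable setT (EFin \o cst a \+ (fun w => s%:E * (X w)%:E))%E.
  by apply: integrableD => //; exact: integrableZl.
by apply: eq_integrable.
Qed.

Let integral_affine_rv (X : {mfun T >-> R}) (a s : R) : P.-integrable setT (EFin \o X) ->
  (\int[P]_w (a + s * X w)%:E = a%:E + s%:E * \int[P]_w (X w)%:E)%E.
Proof.
move=> iX; rewrite -integralZl//.
have -> : a%:E = (\int[P]_w (cst a w)%:E)%E.
  by have := expectation_cst P a; rewrite unlock => ->.
rewrite -(integralD measurableT (icst a) (integrableZl measurableT s iX)).
exact: eq_integral.
Qed.

Let integrable_angle (X : {mfun T >-> R}) t : P.-integrable setT (EFin \o X) ->
  P.-integrable setT (EFin \o (fun w => Num.max (t - X w) 0)).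
Proof.
move=> iX; apply: le_integrable (integrable_affine t (- 1) iX) => //.
  by apply/measurable_EFinP; apply: measurable_maxr => //; exact: measurable_funB.
move=> w _; rewrite /= lee_fin mulN1r.
by case: (leP (t - X w) 0) => // _; rewrite normr0.
Qed.

Section ConcaveTest.
Variable phi : R -> R.
Hypothesis phi_concave : concave phi.
Hypothesis phi_nd : {homo phi : x y / x <= y}.

Let integrable_interpolation (X : {mfun T >-> R}) m e n : P.-integrable setT (EFin \o X) ->
  P.-integrable setT (EFin \o (fun w => interpolation phi m e n (X w))).
Proof.
move=> iX; elim: n => [|n IH].
  apply: eq_integrable (integrable_affine
    (phi (node m e 0 + e) - slope phi m e 0 * node m e 0) (slope phi m e 0) iX) => //.
  by move=> w _; rewrite /= interpolation0.
have iA := integrable_angle (node m e n.+1) iX.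
have : P.-integrable setT ((EFin \o (fun w => interpolation phi m e n (X w))) \-
    (fun w => (slope phi m e n.+1 - slope phi m e n)%:E *
      (Num.max (node m e n.+1 - X w) 0)%:E))%E.
  by apply: integrableB => //; exact: integrableZl.
by apply: eq_integrable => // w _; rewrite /= interpolationS.
Qed.

(** The affine part has equal expectations because the means agree; each angle function enters with
    a nonpositive coefficient, so [angle] is reversed. *)
Let interpolation_expectation_le m e n : 0 < e ->
  (\int[P]_w (interpolation phi m e n (U w))%:E <=
   \int[P]_w (interpolation phi m e n (V w))%:E)%E.
Proof.
move=> e0; elim: n => [|n IH].
  have E (X : {mfun T >-> R}) : P.-integrable setT (EFin \o X) ->
      (\int[P]_w (interpolation phi m e 0 (X w))%:E =
      (phi (node m e 0 + e) - slope phi m e 0 * node m e 0)%:E +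
      (slope phi m e 0)%:E * \int[P]_w (X w)%:E)%E.
    move=> iX; rewrite -integral_affine_rv//; apply: eq_integral => w _.
    by rewrite interpolation0.
  by rewrite !E// EUV.
have E (X : {mfun T >-> R}) : P.-integrable setT (EFin \o X) ->
    (\int[P]_w (interpolation phi m e n.+1 (X w))%:E =
    \int[P]_w (interpolation phi m e n (X w))%:E -
    (slope phi m e n.+1 - slope phi m e n)%:E *
      \int[P]_w (Num.max (node m e n.+1 - X w) 0)%:E)%E.
  move=> iX; have iA := integrable_angle (node m e n.+1) iX.
  have iI := integrable_interpolation m e n iX.
  rewrite -integralZl// -integralB//; last exact: integrableZl.
  by apply: eq_integral => w _; rewrite interpolationS.
rewrite !E//; apply: leeB => //.
by rewrite lee_wpmul2l// lee_fin subr_ge0 slope_nd.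
Qed.

(** The grids have spacing [1 / (n + 1)] and run from [n + 1] down to [- (n + 1) - e_ n]: the mesh
    tends to 0 while they exhaust the line. *)
Let e_ (n : nat) : R := n.+1%:R^-1.
Let f_ (n : nat) := interpolation phi (n.+1 ^ 2) (e_ n) (2 * n.+1 ^ 2 + 1).

Let e_gt0 n : 0 < e_ n. Proof. by rewrite invr_gt0. Qed.

Let e_le1 n : e_ n <= 1. Proof. by rewrite invf_le1// ler1n. Qed.

Let node0E n : node (n.+1 ^ 2) (e_ n) 0 = n.+1%:R.
Proof. by rewrite /node subr0 natrX expr2 -mulrA divff ?mulr1. Qed.

Let nodeE n : node (n.+1 ^ 2) (e_ n) (2 * n.+1 ^ 2 + 1) = - n.+1%:R - e_ n.
Proof.
rewrite /node natrD natrM natrX /e_; field.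
by rewrite gt_eqF.
Qed.

Let f_ge n x : phi x <= f_ n x. Proof. exact: interpolation_ge. Qed.

Let bound (x : R) := phi 0 + (phi 0 - phi (- 1)) * (`|x| + 2).

Let f_le n x : f_ n x <= bound x.
Proof.
apply: interpolation_le => //; first by rewrite node0E.
by rewrite nodeE subrK oppr_le0.
Qed.

(** Once the grid covers [x], the value lies between [phi x] and [phi (x + 2 * e_ n)], and
    [concave_increment] bounds the latter by a term linear in [e_ n]. *)
Let f_cvg x : f_ n x @[n --> \oo] --> phi x.
Proof.
have e_cvg : e_ n @[n --> \oo] --> (0 : R) by exact: cvg_harmonic.
apply: (@squeeze_cvgr _ _ _ _ (cst (phi x))
    (fun n => phi x + 2 * e_ n * (phi x - phi (x - 1)))) => //.
- near=> n.
  rewrite f_ge /=.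
  have hx : `|x| <= n.+1%:R.
    by rewrite (le_trans (ltW (truncnS_gt _)))// ler_nat ltnS; near: n; exact: nbhs_infty_ge.
  have /andP[_ h] : phi x <= f_ n x <= phi (x + 2 * e_ n).
    apply: interpolation_middle => //.
      by rewrite nodeS nodeE; have := e_gt0 n; have := ler_norm (- x); rewrite normrN; lra.
    by rewrite node0E (le_trans (ler_norm _)).
  apply: le_trans h _; apply: concave_increment => //.
  by rewrite mulr_ge0// ltW.
- exact: cvg_cst.
- rewrite -[X in _ --> X]addr0; apply: cvgD; first exact: cvg_cst.
  rewrite -(mul0r (phi x - phi (x - 1))); apply: cvgMr_tmp.
  by rewrite -(mulr0 2); apply: cvgMl_tmp.
Unshelve. all: by end_near. Qed.

Let measurable_phi (X : {mfun T >-> R}) : measurable_fun setT (fun w => phi (X w)).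
Proof. by apply: measurableT_comp => //; exact: nondecreasing_measurable. Qed.

Let integrable_bound (X : {mfun T >-> R}) : P.-integrable setT (EFin \o X) ->
  P.-integrable setT (EFin \o (fun w => bound (X w))).
Proof.
move=> iX.
have : P.-integrable setT (EFin \o cst (phi 0 + (phi 0 - phi (- 1)) * 2)%R \+
    (fun w => (phi 0 - phi (- 1))%R%:E * (`|X w|)%:E))%E.
  by apply: integrableD => //; apply: integrableZl => //; exact: integrable_norm.
apply: eq_integrable => // w _ /=; congr EFin; rewrite /bound; ring.
Qed.

Let f_cvg_bound x : ((bound x - f_ n x)%:E @[n --> \oo] --> (bound x - phi x)%:E)%E.
Proof.
apply: cvg_EFin; first exact: nearW.
by apply: cvgB; [exact: cvg_cst|exact: f_cvg].
Qed.

(** Pass to the limit in the interpolations by Fatou's lemma, applied to the nonnegative functions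
    [bound (V w) - f_ n (V w)]. *)
Lemma angle_concave_le : (\int[P]_w (phi (U w))%:E <= \int[P]_w (phi (V w))%:E)%E.
Proof.
have phi_bound x : phi x <= bound x.
  exact: le_trans (f_ge 0 x) (f_le 0 x).
have iB := integrable_bound iV.
have EB := fineK (integrable_fin_num measurableT iB).
have mphi (X : {mfun T >-> R}) : measurable_fun setT (fun w => (phi (X w))%:E).
  exact/measurable_EFinP.
(* The positive part of [phi (U w)] is integrable in any case, thanks to [bound]; failure of
   integrability thus means expectation [-oo]. *)
have [iphi|niphi] := pselect (P.-integrable setT (EFin \o (fun w => phi (U w)))); last first.
  have pos_fin : (\int[P]_w (fun w => (phi (U w))%:E)^\+ w < +oo)%E.
    have iBU := integrable_bound iU.
    apply: le_lt_trans (integral_funepos_lt_pinfty measurableT iBU).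
    apply: ge0_le_integral => //;
      [exact: measurable_funepos|exact: measurable_funepos (measurable_int _ iBU)|].
    by move=> w _; apply: (@funepos_le _ _ setT) => // [z _|]; rewrite ?lee_fin ?inE.
  suff -> : (\int[P]_w (phi (U w))%:E = -oo)%E by rewrite leNye.
  rewrite integralE; have [neg_fin|] := ltP (\int[P]_w (fun w => (phi (U w))%:E)^\- w)%E +oo%E.
    exfalso; apply: niphi; apply/integrableP; split; first exact: mphi.
    rewrite (eq_integral ((fun w => (phi (U w))%:E)^\+ \+
        (fun w => (phi (U w))%:E)^\-)%E); last first.
      by move=> w _; have /(congr1 (@^~ w)) := fune_abse (fun w => (phi (U w))%:E).
    rewrite ge0_integralD//;
      [exact: lte_add_pinfty|exact: measurable_funepos|exact: measurable_funeneg].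
  rewrite leye_eq => /eqP ->; rewrite addeNy//.
have Ephi := fineK (integrable_fin_num measurableT iphi).
have mB := iffLR (measurable_EFinP _ _) (measurable_int _ iB).
have mF n : measurable_fun setT (fun w => (bound (V w) - f_ n (V w))%:E).
  have m2 := iffLR (measurable_EFinP _ _) (measurable_int _
    (integrable_interpolation (n.+1 ^ 2) (e_ n) (2 * n.+1 ^ 2 + 1) iV)).
  by apply/measurable_EFinP; exact: measurable_funB.
have H n : (\int[P]_w (bound (V w) - f_ n (V w))%:E <=
   \int[P]_w (bound (V w))%:E - \int[P]_w (phi (U w))%:E)%E.
  have iI := integrable_interpolation (n.+1 ^ 2) (e_ n) (2 * n.+1 ^ 2 + 1) iV.
  have iIU := integrable_interpolation (n.+1 ^ 2) (e_ n) (2 * n.+1 ^ 2 + 1) iU.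
  have -> : (\int[P]_w (bound (V w) - f_ n (V w))%:E =
      \int[P]_w (bound (V w))%:E - \int[P]_w (f_ n (V w))%:E)%E.
    by rewrite -integralB.
  apply: leeB => //; apply: le_trans (interpolation_expectation_le _ _ (e_gt0 n)).
  by apply: le_integral => // w _; rewrite lee_fin f_ge.
have fat : (\int[P]_w (bound (V w) - phi (V w))%:E <=
   \int[P]_w (bound (V w))%:E - \int[P]_w (phi (U w))%:E)%E.
  rewrite (eq_integral (fun w => limn_einf (fun n => (bound (V w) - f_ n (V w))%:E))); last first.
    move=> w _; have h := @f_cvg_bound (V w).
    by rewrite is_cvg_limn_einfE; [apply/esym/cvg_lim|apply/cvg_ex; eexists; exact: h].
  apply: le_trans (fatou P measurableT mF _) _.
    by move=> n w _; rewrite lee_fin subr_ge0.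
  rewrite limn_einf_lim; apply: lime_le; first exact: is_cvg_einfs.
  apply: nearW => n; apply: le_trans (H n).
  by apply: ereal_inf_lbound; exists n => /=.
(* The finite bound from Fatou also yields integrability of [phi (V w)], which permits splitting the
   integral and cancelling [bound]. *)
have iBphi : P.-integrable setT (EFin \o (fun w => bound (V w) - phi (V w))).
  apply/integrableP; split; first by apply/measurable_EFinP; exact: measurable_funB.
  rewrite (eq_integral (fun w => (bound (V w) - phi (V w))%:E)); last first.
    by move=> w _; rewrite gee0_abs// lee_fin subr_ge0.
  by apply: le_lt_trans fat _; rewrite -EB -Ephi -EFinB ltry.
have iphiV : P.-integrable setT (EFin \o (fun w => phi (V w))).
  have := integrableB measurableT iB iBphi; apply: eq_integrable => // w _.
  by rewrite /=; congr EFin; ring.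
have EphiV := fineK (integrable_fin_num measurableT iphiV).
move: fat; have -> : (\int[P]_w (bound (V w) - phi (V w))%:E =
      \int[P]_w (bound (V w))%:E - \int[P]_w (phi (V w))%:E)%E.
  by rewrite -integralB.
by rewrite -EB -Ephi -EphiV -!EFinB !lee_fin lerD2l lerN2.
Qed.

End ConcaveTest.

Lemma angle_ssd : ssd P V U.
Proof.
move=> phi phi_concave phi_nd _ _; rewrite unlock.
exact: angle_concave_le.
Qed.

End AngleFunctions.

(** * Functionals monotone in the variance *)

Section VarianceComparison.
Context d (T : measurableType d) (R : realType) (P : probability T R).
Implicit Types X Y Z : {mfun T >-> R}.

Lemma moment_fin_num X n : finite_moments P X ->
  'E_P[fun w => (`|X w| ^+ n)%R]%E \is a fin_num.
Proof.
move=> hX; rewrite ge0_fin_numE; first exact: hX.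
by apply: expectation_ge0 => w; rewrite exprn_ge0.
Qed.

Lemma variance_centered X : finite_moments P X -> ('E_P[X] = 0)%E ->
  ('V_P[X] = 'E_P[(X ^+ 2)%R])%E.
Proof.
by move=> hX X0; rewrite varianceE ?finite_moments_Lfun2// X0 expe2 mule0 sube0.
Qed.

(** One noise law, chosen from the laws of [X] and [Y] before any copies are drawn, serves both sums
    and all [t]; this is what lets additivity cancel the noise. *)
Lemma exists_smoothing_noise X Y : finite_moments P X -> finite_moments P Y ->
  ('E_P[X] = 0)%E -> ('E_P[Y] = 0)%E -> ('V_P[Y] < 'V_P[X])%E ->
  exists nu : probability R R,
    (forall n, (\int[nu]_x (`|x| ^+ n)%:E < +oo)%E) /\
    forall X' Y' Z Z', same_law P X X' -> same_law P Y Y' ->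
      independent_pair P X' Z -> independent_pair P Y' Z' ->
      (forall B, measurable B -> distribution P Z B = nu B) ->
      (forall B, measurable B -> distribution P Z' B = nu B) ->
      forall t, (\int[P]_w (Num.max (t - (Y' w + Z' w)) 0)%:E <=
                 \int[P]_w (Num.max (t - (X' w + Z w)) 0)%:E)%E.
Proof.
move=> mX mY X0 Y0.
have VXf : 'V_P[X]%E \is a fin_num by apply/variance_fin_num/finite_moments_Lfun2.
have VYf : 'V_P[Y]%E \is a fin_num by apply/variance_fin_num/finite_moments_Lfun2.
rewrite -(fineK VXf) -(fineK VYf) lte_fin.
set vX := fine 'V_P[X]; set vY := fine 'V_P[Y] => vYX.
(* A common bound for the moments of both variables, so that the same weights work for [X] and
   [Y]. *)
pose M n := fine 'E_P[fun w => (`|X w| ^+ n.+2)%R] + fine 'E_P[fun w => (`|Y w| ^+ n.+2)%R].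
have M0 n : 0 <= M n.
  by rewrite addr_ge0// fine_ge0//; apply: expectation_ge0 => w; rewrite exprn_ge0.
(* Each of the two expansions has error [eps * expR 1] in the variance, so twice that must fit into
   the gap [vX - vY]. *)
pose eps := Num.min 1 ((vX - vY) / (2 * expR 1)).
have eps0 : 0 < eps.
  by rewrite lt_min ltr01/= divr_gt0 ?subr_gt0// mulr_gt0// expR_gt0.
have eps1 : eps <= 1 by rewrite ge_min lexx.
have epsv : 2 * (eps * expR 1) <= vX - vY.
  have : eps <= (vX - vY) / (2 * expR 1) by rewrite ge_min lexx orbT.
  by rewrite ler_pdivlMr ?mulr_gt0 ?expR_gt0// mulrCA.
have [b [b0 b_gt0 b_sub b_le1 bM]] := exists_weights M0 eps0 eps1.
have b_ge0 n : 0 <= b n by exact: ltW.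
have [c [nu [c_gt0 nuE nuM]]] := exists_noise b0 b_gt0 b_le1.
exists nu; split => // X' Y' Z Z' XX' YY' iXZ iYZ lZ lZ' t.
have nu1 : (\int[nu]_x `|x|%:E < +oo)%E.
  by have := nuM 1; under eq_integral do rewrite expr1.
have [A [p [k [k0 bnd]]]] := noise_expansion b0 b_ge0 b_sub b_le1 c_gt0 nuE nu1 t.
have mG : measurable_fun setT (fun x : R => wexp b `|x|) by exact: measurable_wexp_norm.
have G0 (x : R) : 0 <= wexp b `|x|.
  exact: le_trans ler01 (wexp_ge1 b0 b_ge0 b_le1 (normr_ge0 x)).
have key W W' : finite_moments P W -> ('E_P[W] = 0)%E ->
    (forall n, 'E_P[fun w => (`|W w| ^+ n.+2)%R] <= (M n)%:E)%E ->
    same_law P W W' ->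
  [/\ finite_moments P W', ('E_P[W'] = 0)%E, ('E_P[(W' ^+ 2)%R] = 'V_P[W])%E &
     (\int[P]_w ((W' w) ^+ 2 * wexp b `|W' w|)%:E <= 'E_P[(W' ^+ 2)%R] + (eps * expR 1)%:E)%E].
  move=> mW W0 hM WW'.
  have mW' := same_law_moments WW' mW.
  have W'0 : ('E_P[W'] = 0)%E by rewrite -W0; apply/esym/(same_law_expectation (g := id) WW').
  split => //.
  - by rewrite -variance_centered// (same_law_variance WW').
  - apply: (integral_sqr_wexp_le b0 b_ge0 b_le1 bM (ltW eps0)) => n.
    rewrite -(same_law_expectation (g := fun x => `|x| ^+ n.+2) WW'); first exact: hM.
    by apply: measurable_funX; exact: normr_measurable.
have hMX n : ('E_P[fun w => (`|X w| ^+ n.+2)%R] <= (M n)%:E)%E.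
  rewrite -(fineK (moment_fin_num n.+2 mX)) lee_fin lerDl fine_ge0//.
  by apply: expectation_ge0 => w; rewrite exprn_ge0.
have hMY n : ('E_P[fun w => (`|Y w| ^+ n.+2)%R] <= (M n)%:E)%E.
  rewrite -(fineK (moment_fin_num n.+2 mY)) lee_fin lerDr fine_ge0//.
  by apply: expectation_ge0 => w; rewrite exprn_ge0.
have [mX' X'0 X'2 hX'] := key X X' mX X0 hMX XX'.
have [mY' Y'0 Y'2 hY'] := key Y Y' mY Y0 hMY YY'.
have /andP[lX _] := noisy_angle_bounds mG G0 k0 bnd iXZ lZ mX' X'0 hX'.
have /andP[_ uY] := noisy_angle_bounds mG G0 k0 bnd iYZ lZ' mY' Y'0 hY'.
apply: le_trans uY _; apply: le_trans lX.
rewrite X'2 Y'2 -(fineK VXf) -(fineK VYf) -/vX -/vY.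
rewrite -EFinD -EFinB -!EFinM -!EFinD lee_fin lerD2l ler_wpM2l//.
lra.
Qed.

End VarianceComparison.

(** * Additive monotone functionals are linear in the variance *)

Section AdditiveFunctional.
Context d (T : measurableType d) (R : realType) (P : probability T R).
Hypothesis hP : rich P.
Variable C : Pinfty P -> R.
Hypothesis C_certainty : forall x : R, C (Pinfty_cst P x) = x.
Hypothesis C_monotone : forall X Y : Pinfty P, mean_preserving_spread P X Y -> C X <= C Y.
Hypothesis C_additive : forall X Y : Pinfty P, independent_pair P X Y ->
  C (Pinfty_add X Y) = C X + C Y.
Implicit Types X Y : Pinfty P.

Lemma functional_same_law X Y : same_law P X Y -> C X = C Y.
Proof.
move=> XY; apply/le_anti/andP; split; apply/C_monotone/same_law_mean_preserving_spread => //.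
exact: same_law_sym.
Qed.

Let Lfun1 X : (X : T -> R) \in Lfun P 1.
Proof. exact/finite_moments_Lfun1/Pinfty_moments. Qed.

Let Lfun2 X : (X : T -> R) \in Lfun P 2%:E.
Proof. exact/finite_moments_Lfun2/Pinfty_moments. Qed.

Lemma Pinfty_expectationD X Y : ('E_P[Pinfty_add X Y] = 'E_P[X] + 'E_P[Y])%E.
Proof. by rewrite -(expectationD (Lfun1 X) (Lfun1 Y)). Qed.

Lemma independent_cst X (c : R) : independent_pair P X (Pinfty_cst P c).
Proof.
move=> A B mA mB.
have [Bc|Bc] := pselect (B c).
  have -> : (Pinfty_cst P c : T -> R) @^-1` B = setT by apply/seteqP; split.
  by rewrite setIT probability_setT mule1.
have -> : (Pinfty_cst P c : T -> R) @^-1` B = set0 by apply/seteqP; split.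
by rewrite setI0 measure0 mule0.
Qed.

Lemma Pinfty_copies X (nu : probability R R) :
  (forall n, (\int[nu]_x (`|x| ^+ n)%:E < +oo)%E) ->
  exists X' Z : Pinfty P, [/\ independent_pair P X' Z, same_law P X X' &
    forall B, measurable B -> distribution P Z B = nu B].
Proof.
move=> nuM.
have [X' [Z [iXZ lX lZ]]] := rich_pair (distribution P X) nu hP.
have XX' : same_law P X X' by move=> A mA; rewrite lX.
have mZ : finite_moments P Z.
  move=> n; rewrite unlock.
  have mf : measurable_fun setT (fun x : R => (`|x| ^+ n)%:E).
    by apply/measurable_EFinP/measurable_funX; exact: normr_measurable.
  rewrite -(ge0_integral_distribution Z mf); last by move=> x; rewrite lee_fin exprn_ge0.
  apply: le_lt_trans (nuM n); rewrite le_eqVlt; apply/orP; left; apply/eqP.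
  by apply: eq_measure_integral => A mA _; exact: lZ.
by exists (MkPinfty (same_law_moments XX' (Pinfty_moments X))), (MkPinfty mZ).
Qed.

(** With copies and noises of a common law, [C X + C Z = C (X' + Z) <= C (Y' + Z') = C Y + C Z]. *)
Lemma functional_variance_anti X Y : ('E_P[X] = 0)%E -> ('E_P[Y] = 0)%E ->
  ('V_P[Y] < 'V_P[X])%E -> C X <= C Y.
Proof.
move=> X0 Y0 VYX.
have [nu [nuM nuP]] := exists_smoothing_noise (Pinfty_moments X)
  (Pinfty_moments Y) X0 Y0 VYX.
have [X' [Z [iXZ XX' lZ]]] := Pinfty_copies X nuM.
have [Y' [Z' [iYZ YY' lZ']]] := Pinfty_copies Y nuM.
have ZZ' : same_law P Z Z' by move=> A mA; rewrite lZ// lZ'.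
have := nuP X' Y' Z Z' XX' YY' iXZ iYZ lZ lZ'.
rewrite -(lerD2r (C Z)) [in leLHS](functional_same_law XX') -C_additive//.
rewrite [in leRHS](functional_same_law YY') [in leRHS](functional_same_law ZZ') -C_additive//.
move=> angle; apply: C_monotone.
have EE : ('E_P[Pinfty_add X' Z] = 'E_P[Pinfty_add Y' Z'])%E.
  rewrite !Pinfty_expectationD -(same_law_expectation (g := id) XX')//.
  rewrite -(same_law_expectation (g := id) YY')//.
  by rewrite -(same_law_expectation (g := id) ZZ')//= X0 Y0.
split => //; apply: angle_ssd.
- exact/Lfun1_integrable.
- exact/Lfun1_integrable.
- by move: EE; rewrite unlock.
- exact: angle.
Qed.

(** [X] and [Y] may be dependent, so the sum is taken over independent copies, which [C] does not
    distinguish from the originals. *)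
Lemma functional_sum X Y : exists S : Pinfty P,
  [/\ 'E_P[S]%E = ('E_P[X] + 'E_P[Y])%E, 'V_P[S]%E = ('V_P[X] + 'V_P[Y])%E & C S = C X + C Y].
Proof.
have [X' [Y' [iXY lX lY]]] := rich_pair (distribution P X) (distribution P Y) hP.
have XX' : same_law P X X' by move=> A mA; rewrite lX.
have YY' : same_law P Y Y' by move=> A mA; rewrite lY.
have mX' := same_law_moments XX' (Pinfty_moments X).
have mY' := same_law_moments YY' (Pinfty_moments Y).
exists (Pinfty_add (MkPinfty mX') (MkPinfty mY')); split.
- rewrite Pinfty_expectationD -(same_law_expectation (g := id) XX')//.
  by rewrite -(same_law_expectation (g := id) YY').
- rewrite (varianceD_independent mX' mY' iXY).
  by rewrite (same_law_variance XX') (same_law_variance YY').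
- by rewrite C_additive// (@functional_same_law X (MkPinfty mX'))//
    (@functional_same_law Y (MkPinfty mY')).
Qed.

Lemma functional_muln X n : ('E_P[X] = 0)%E -> exists S : Pinfty P,
  [/\ 'E_P[S]%E = 0%E, 'V_P[S]%E = (n%:R%:E * 'V_P[X])%E & C S = n%:R * C X].
Proof.
move=> X0; elim: n => [|n [S [S0 VS CS]]].
  exists (Pinfty_cst P 0); split; first exact: expectation_cst.
    by rewrite mul0e; exact: variance_cst.
  by rewrite C_certainty mul0r.
have [S' [ES' VS' CS']] := functional_sum S X.
exists S'; split.
- by rewrite ES' S0 X0 adde0.
- by rewrite VS' VS -natr1 EFinD muleDl ?mul1e// ?fin_num_adde_defl// variance_fin_num.
- by rewrite CS' CS -natr1 mulrDl mul1r.
Qed.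

Let V X := fine 'V_P[X]%E.

Let EFin_V X : (V X)%:E = 'V_P[X]%E.
Proof. by rewrite fineK// variance_fin_num. Qed.

Let V_ge0 X : 0 <= V X. Proof. by rewrite fine_ge0// variance_ge0. Qed.

Lemma functional_muln_anti X Y (m n : nat) : ('E_P[X] = 0)%E -> ('E_P[Y] = 0)%E ->
  m%:R * V Y < n%:R * V X -> n%:R * C X <= m%:R * C Y.
Proof.
move=> X0 Y0 lt.
have [S [S0 VS <-]] := functional_muln n X0.
have [S' [S'0 VS' <-]] := functional_muln m Y0.
by apply: functional_variance_anti => //; rewrite VS VS' -!EFin_V -!EFinM lte_fin.
Qed.

Let centered X : Pinfty P := Pinfty_add X (Pinfty_cst P (- fine 'E_P[X]%E)).

Let expectation_centered X : 'E_P[centered X]%E = 0%E.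
Proof.
rewrite Pinfty_expectationD [X in (_ + X)%E]expectation_cst EFinN fineK ?subee//;
  exact: expectation_fin_num.
Qed.

Let variance_centering X : V (centered X) = V X.
Proof. by congr fine; exact: (varianceD_cst_r _ (Lfun2 X)). Qed.

(** A centered fair coin; richness is what realizes its law on [T]. *)
Let exists_centered : exists B : Pinfty P, 'E_P[B]%E = 0%E /\ 0 < V B.
Proof.
pose f (x : bool) : R := x%:R.
have mf : measurable_fun setT f by [].
pose F : {mfun bool >-> R} := mfun_Sub (mem_set mf).
have half : (0 <= (2^-1 : R) <= 1)%R by lra.
pose nu := distribution (bernoulli_prob (2^-1 : R)) F.
have nuE (g : R -> \bar R) : measurable_fun setT g -> (forall x, 0 <= g x)%E ->
    (\int[nu]_x g x = 2^-1%:E * g 1%R + (1 - 2^-1)%:E * g 0%R)%E.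
  move=> mg g0; rewrite ge0_integral_distribution//.
  by rewrite integral_bernoulli_prob// => x; exact: g0.
have mn n : measurable_fun setT (fun x : R => (`|x| ^+ n)%:E).
  by apply/measurable_EFinP/measurable_funX; exact: normr_measurable.
have nun n : (\int[nu]_x (`|x| ^+ n.+1)%:E = 2^-1%:E)%E.
  rewrite nuE//.
  by rewrite normr1 normr0 expr1n expr0n/= mule1 mule0 adde0.
(* Only the second component matters: an element of [Pinfty P] with law [nu]. *)
have [|_ [Z [_ _ lZ]]] := @Pinfty_copies (Pinfty_cst P 0) nu.
  move=> n; rewrite nuE//.
  by rewrite -!EFinM -EFinD ltry.
have ZE n : (\int[P]_w (`|Z w| ^+ n.+1)%:E = 2^-1%:E)%E.
  rewrite -(nun n) -(ge0_integral_distribution Z (mn n.+1)); last first.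
    by move=> x; rewrite lee_fin exprn_ge0.
  by apply: eq_measure_integral => A mA _; exact: lZ.
exists (centered Z); split; first exact: expectation_centered.
rewrite variance_centering -lte_fin EFin_V varianceE//.
have -> : ('E_P[((Z : T -> R) ^+ 2)%R] = 2^-1%:E)%E.
  rewrite unlock -(ZE 1); apply: eq_integral => w _.
  by rewrite -normrX ger0_norm// sqr_ge0.
(* With second moment 1/2 and mean at most 1/2 in absolute value, the variance is at least 1/4. *)
have EZ : (`|'E_P[Z]| <= 2^-1%:E)%E.
  rewrite unlock -(ZE 0); apply: le_trans (le_abse_integral _ measurableT _) _.
    exact/measurable_EFinP.
  by under eq_integral do rewrite /= -(expr1 `|_|).
have := expectation_fin_num (Lfun1 Z) => /fineK EZE.
move: EZ; rewrite -EZE /= lee_fin => EZ.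
rewrite -EFinD lte_fin; move: EZ; rewrite ler_norml => /andP[lo hi].
by nra.
Qed.

Lemma functional_centered : exists2 k : R, 0 <= k &
  forall X, ('E_P[X] = 0)%E -> C X = - (k * V X).
Proof.
have [B [B0 VB]] := exists_centered.
have CB : C B <= 0.
  rewrite -(C_certainty 0); apply: functional_variance_anti => //.
    exact: expectation_cst.
  by rewrite [ltLHS]variance_cst -EFin_V lte_fin.
exists (- (C B / V B)); first by rewrite oppr_ge0 pmulr_lle0// invr_gt0.
move=> X X0; rewrite mulNr opprK.
(* The right-hand side does not depend on [n], so the Archimedean property forces the difference to
   vanish. *)
suff bnd n : n%:R * `|C X - C B / V B * V X| <= 2 * `|C B|.
  apply/eqP; rewrite -subr_eq0 -normr_eq0; apply/eqP/le_anti; rewrite normr_ge0 andbT.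
  rewrite leNgt; apply/negP => lt0.
  have := bnd (Num.truncn (2 * `|C B| / `|C X - C B / V B * V X|)).+1.
  by rewrite -ler_pdivlMr// leNgt truncnS_gt.
have n0 : 0 <= n%:R * V X / V B by rewrite divr_ge0// mulr_ge0.
have /andP[] := truncn_itv n0; set m := Num.truncn _ => mle mlt.
have lo : m.+1%:R * C B <= n%:R * C X.
  have nVX : n%:R * V X < m.+1%:R * V B by rewrite -ltr_pdivrMr.
  exact: functional_muln_anti.
(* The bound [m * V B <= n * V X] may be an equality, whereas the comparison needs a strict one; an
   extra copy of [B] on the side of [X] provides it. *)
have hi : n%:R * C X + C B <= m%:R * C B.
  have [S [S0 VS CS]] := functional_muln n X0.
  rewrite -CS; have [S1 [ES1 VS1 <-]] := functional_sum S B.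
  have [S2 [S20 VS2 <-]] := functional_muln m B0.
  apply: functional_variance_anti => //; first by rewrite ES1 S0 B0 adde0.
  rewrite VS1 VS VS2 -!EFin_V -!EFinM -EFinD lte_fin.
  by move: mle; rewrite ler_pdivlMr//; lra.
rewrite -[n%:R]ger0_norm// -normrM (ler0_norm CB) mulrBr.
have -> : n%:R * (C B / V B * V X) = C B * (n%:R * V X / V B) by ring.
(* Put [r = n * V X / V B], so [m <= r < m + 1]. The difference lies between [(m + 1 - r) * C B] and
   [(m - 1 - r) * C B], where [C B <= 0] and the two factors are at most 1 and at least -2. *)
rewrite ler_norml; apply/andP; split.
- have := @ler_wnM2l _ _ CB 1 (m.+1%:R - n%:R * V X / V B).
  rewrite -natr1 in lo *; move=> h.
  have {}h := h _; lra.
- have := @ler_wnM2l _ _ CB (m%:R - 1 - n%:R * V X / V B) (- 2).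
  rewrite -natr1 in mlt; move=> h.
  have {}h := h _; lra.
Qed.

(** Constants are independent of every variable, so by additivity and certainty centering subtracts
    the mean from [C X]. *)
Lemma functional_mean_variance : exists k : R, 0 <= k /\
  forall X, (C X)%:E = ('E_P[X] - k%:E * 'V_P[X])%E.
Proof.
have [k k0 Ck] := functional_centered.
exists k; split => // X.
have := Ck _ (expectation_centered X).
rewrite variance_centering C_additive; last exact: independent_cst.
rewrite C_certainty => /eqP; rewrite subr_eq addrC => /eqP ->.
by rewrite EFinB EFinM EFin_V fineK// expectation_fin_num.
Qed.

End AdditiveFunctional.

(** * The converse *)

Section SpreadVariance.
Context d (T : measurableType d) (R : realType) (P : probability T R).
Implicit Types X Y : {mfun T >-> R}.

Let loss (m x : R) : R := - (Num.max (m - x) 0) ^+ 2.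

Let max_ge0 (x : R) : 0 <= Num.max x 0.
Proof. by rewrite le_max lexx orbT. Qed.

Let loss_concave m : concave (loss m).
Proof.
move=> t x y /andP[t0 t1].
pose a := Num.max (m - x) 0; pose b := Num.max (m - y) 0.
have a0 : 0 <= a by rewrite le_max lexx orbT.
have b0 : 0 <= b by rewrite le_max lexx orbT.
have ax : m - x <= a by rewrite le_max lexx.
have by_ : m - y <= b by rewrite le_max lexx.
have t1' : 0 <= 1 - t by rewrite subr_ge0.
have h : Num.max (m - (t * x + (1 - t) * y)) 0 <= t * a + (1 - t) * b.
  rewrite ge_max addr_ge0 ?mulr_ge0// andbT.
  have := ler_wpM2l t0 ax; have := ler_wpM2l t1' by_; lra.
rewrite /loss -/a -/b -lerN2 opprK.
apply: (@le_trans _ _ ((t * a + (1 - t) * b) ^+ 2)).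
  by rewrite lerXn2r ?nnegrE ?le_max ?lexx ?orbT// addr_ge0// mulr_ge0.
rewrite -subr_ge0.
have -> : - (t * - a ^+ 2 + (1 - t) * - b ^+ 2) - (t * a + (1 - t) * b) ^+ 2 =
  t * (1 - t) * (a - b) ^+ 2 by ring.
by apply: mulr_ge0; [exact: mulr_ge0|exact: sqr_ge0].
Qed.

Let loss_nd m : {homo loss m : x y / x <= y}.
Proof.
move=> x y xy; rewrite lerN2; apply: lerXn2r; rewrite ?nnegrE ?max_ge0//.
by rewrite ge_max !le_max lexx orbT andbT lerB.
Qed.

Let sqr_max_split (y m : R) :
  (y - m) ^+ 2 = Num.max (m - y) 0 ^+ 2 + Num.max (y - m) 0 ^+ 2.
Proof.
have [ym|my] := leP y m.
  by rewrite max_l ?subr_ge0// max_r ?subr_le0// expr0n addr0 -sqrrN opprB.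
by rewrite max_r ?subr_le0 ?ltW// max_l ?subr_ge0 ?ltW// expr0n add0r.
Qed.

Let sqr_max_le (y : R) : Num.max y 0 ^+ 2 <= y ^+ 2.
Proof.
by have [y0|y0] := leP y 0; rewrite // expr0n/= sqr_ge0.
Qed.

Let integrable_sqr_max X (f : R -> R) (a : R) : finite_moments P X ->
  measurable_fun setT f -> (forall x, f x ^+ 2 <= a + 2 * x ^+ 2) ->
  P.-integrable setT (EFin \o (fun w => Num.max (f (X w)) 0 ^+ 2)).
Proof.
move=> mX mf fx.
apply: (@finite_moments_le_integrable _ _ _ _ X 2 a 2) => //.
  apply: measurable_funX; apply: measurable_maxr => //.
  exact: measurableT_comp.
move=> w; rewrite ger0_norm ?sqr_ge0// -normrX ger0_norm ?sqr_ge0//.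
exact: le_trans (sqr_max_le _) (fx _).
Qed.

Let integrable_lower X m : finite_moments P X ->
  P.-integrable setT (EFin \o (fun w => Num.max (m - X w) 0 ^+ 2)).
Proof.
move=> mX; apply: (@integrable_sqr_max X (fun x => m - x) (2 * m ^+ 2)) => //.
  exact: measurable_funB.
by move=> x; have := sqr_ge0 (m + x); nra.
Qed.

Let integrable_upper X m : finite_moments P X ->
  P.-integrable setT (EFin \o (fun w => Num.max (X w - m) 0 ^+ 2)).
Proof.
move=> mX; apply: (@integrable_sqr_max X (fun x => x - m) (2 * m ^+ 2)) => //.
  exact: measurable_funB.
by move=> x; have := sqr_ge0 (m + x); nra.
Qed.

(** The square is the sum of [- loss m], an upper tail that vanishes as [m] grows, and an affine
    function, whose expectation depends on the mean only. *)
Let integral_sqr X m : finite_moments P X ->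
  (\int[P]_w (X w ^+ 2)%:E = \int[P]_w (Num.max (m - X w) 0 ^+ 2)%:E
    + \int[P]_w (Num.max (X w - m) 0 ^+ 2)%:E
    + ((2 * m)%:E * 'E_P[X] - (m ^+ 2)%:E))%E.
Proof.
move=> mX.
have iX : P.-integrable setT (EFin \o X) by exact/Lfun1_integrable/finite_moments_Lfun1.
have iL := integrable_lower m mX; have iU := integrable_upper m mX.
have icst : P.-integrable setT (EFin \o cst (m ^+ 2)) by exact: finite_measure_integrable_cst.
have -> : ((m ^+ 2)%:E = \int[P]_w (cst (m ^+ 2) w)%:E)%E.
  by have := expectation_cst P (m ^+ 2); rewrite unlock.
rewrite unlock -integralZl// -integralB//; last exact: integrableZl.
rewrite -integralD// -integralD//; last 2 first.
- exact: integrableD.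
- by apply: integrableB => //; exact: integrableZl.
apply: eq_integral => w _ /=; congr EFin.
have := sqr_max_split (X w) m; rewrite !expr2; lra.
Qed.

Let loss_well_defined X m : expectation_well_defined P (loss m \o X).
Proof.
left; rewrite (eq_integral (cst 0%E)) ?integral0// => w _.
by rewrite funeposE /= max_r// lee_fin oppr_le0 sqr_ge0.
Qed.

Let integral_lower_le X Y m : ssd P Y X ->
  (\int[P]_w (Num.max (m - Y w) 0 ^+ 2)%:E <= \int[P]_w (Num.max (m - X w) 0 ^+ 2)%:E)%E.
Proof.
move=> /(_ _ (loss_concave m) (@loss_nd m) (loss_well_defined _ _) (loss_well_defined _ _)).
have E Z : ('E_P[loss m \o Z] = - \int[P]_w (Num.max (m - Z w) 0 ^+ 2)%:E)%E.
  rewrite unlock -integral_ge0N; last by move=> w _; rewrite lee_fin sqr_ge0.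
  by apply: eq_integral => w _; rewrite /= /loss EFinN.
by rewrite !E leeN2.
Qed.

(** Dominated convergence: the integrand is at most [X w ^+ 2] and vanishes once [n] exceeds
    [X w]. *)
Let upper_cvg0 X : finite_moments P X ->
  (\int[P]_w (Num.max (X w - n%:R) 0 ^+ 2)%:E @[n --> \oo] --> 0)%E.
Proof.
move=> mX.
rewrite -(integral0 P setT).
apply: (@dominated_cvg _ _ _ P setT measurableT _ _ (fun w => (X w ^+ 2)%:E)) => //.
- by move=> n; exact: measurable_int (integrable_upper _ mX).
- move=> w _; apply: cvg_near_cst; near=> n.
  apply/eqP; rewrite eqe max_r ?expr0n//= subr_le0.
  rewrite (le_trans (ler_norm _))// (le_trans (ltW (truncnS_gt _)))//.
  by rewrite ler_nat; near: n; exact: nbhs_infty_ge.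
- exact: Lfun2_integrable_sqr (finite_moments_Lfun2 mX).
- move=> n w _; rewrite gee0_abs ?lee_fin ?sqr_ge0//.
  have [Xn|nX] := leP (X w - n%:R) 0; first by rewrite expr0n sqr_ge0.
  have n0 : 0 <= n%:R :> R by [].
  nra.
Unshelve. all: by end_near. Qed.

Lemma mean_preserving_spread_variance X Y : finite_moments P X -> finite_moments P Y ->
  mean_preserving_spread P X Y -> ('V_P[Y] <= 'V_P[X])%E.
Proof.
move=> mX mY [EXY XY].
have finX := integrable_fin_num measurableT (Lfun2_integrable_sqr (finite_moments_Lfun2 mX)).
rewrite !varianceE ?finite_moments_Lfun2// EXY leeB//.
have E2 Z : ('E_P[((Z : T -> R) ^+ 2)%R] = \int[P]_w (Z w ^+ 2)%:E)%E by rewrite unlock.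
rewrite !E2.
(* Dominance compares the lower parts, the affine parts agree since the means do, and the upper tail
   of [X] is dropped; only that of [Y] remains. *)
have H n : (\int[P]_w (Y w ^+ 2)%:E - \int[P]_w (X w ^+ 2)%:E <=
    \int[P]_w (Num.max (Y w - n%:R) 0 ^+ 2)%:E)%E.
  rewrite leeBlDr// (integral_sqr n%:R mX) (integral_sqr n%:R mY) EXY.
  rewrite [leRHS]addeA; apply: leeD => //; rewrite addeC; apply: leeD2l.
  apply: le_trans (integral_lower_le _ XY) _.
  by rewrite leeDl// integral_ge0// => w _; rewrite lee_fin sqr_ge0.
rewrite -sube_le0//.
rewrite -(cvg_lim _ (upper_cvg0 mY))//; apply: lime_ge.
  by apply/cvg_ex; eexists; exact: upper_cvg0.
exact: nearW.
Qed.

End SpreadVariance.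

Unset Implicit Arguments.

Theorem proposition1 (d : measure_display) (T : measurableType d)
    (R : realType) (P : probability T R) (hP : rich P) (C : Pinfty P -> R) :
  ((forall x : R, C (Pinfty_cst P x) = x) /\
   (forall X Y : Pinfty P, mean_preserving_spread P X Y -> C X <= C Y) /\
   (forall X Y : Pinfty P, independent_pair P X Y ->
      C (Pinfty_add X Y) = C X + C Y))
  <->
  (exists k : R, 0 <= k /\
     forall X : Pinfty P, (C X)%:E = ('E_P[X] - k%:E * 'V_P[X])%E).
Proof.
split=> [[C_cst [C_mono C_add]]|[k [k0 CE]]].
  exact: (functional_mean_variance hP C_cst C_mono C_add).
have E1 (X : Pinfty P) := finite_moments_Lfun1 (Pinfty_moments X).
have E2 (X : Pinfty P) := finite_moments_Lfun2 (Pinfty_moments X).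
split; [|split].
- move=> x; apply: EFin_inj; rewrite CE.
  by rewrite [X in (X - _)%E]expectation_cst [X in (_ - _ * X)%E]variance_cst mule0 sube0.
- move=> X Y XY; rewrite -lee_fin !CE; have [-> _] := XY.
  apply: leeB => //; rewrite lee_wpmul2l// ?lee_fin//.
  exact: (mean_preserving_spread_variance (Pinfty_moments X) (Pinfty_moments Y) XY).
- move=> X Y XY; apply: EFin_inj; rewrite EFinD !CE Pinfty_expectationD.
  rewrite (varianceD_independent (Pinfty_moments X) (Pinfty_moments Y) XY).
  rewrite -(fineK (expectation_fin_num (E1 X))) -(fineK (expectation_fin_num (E1 Y))).
  rewrite -(fineK (variance_fin_num (E2 X))) -(fineK (variance_fin_num (E2 Y))).
  by rewrite -!(EFinD, EFinM, EFinN); congr EFin; ring.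
Qed.
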